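(* Let $L>0$ and let $\alpha,\beta,\gamma,\delta\ge 0$ with $\gamma\beta+\alpha\gamma+\alpha\delta>0$. Let $a,b\colon[0,L]\to[0,+\infty)$ be continuous functions such that there exist $0<\tau<\sigma<L$ with $$a(x)>0 \text{ on } \,]0,\tau[\,\cup\,]\sigma,L[,\qquad a\equiv 0 \text{ on } [\tau,\sigma],$$ $$b(x)>0 \text{ on } \,]\tau,\sigma[,\qquad b\equiv 0 \text{ on } [0,\tau]\cup[\sigma,L].$$ Let $g,k\colon[0,+\infty)\to[0,+\infty)$ be continuous with $g(0)=k(0)=0$ and $g(s)>0$, $k(s)>0$ for all $s>0$. Assume $$\limsup_{s\to0^{+}}\frac{g(s)}{s}=0,\qquad \liminf_{s\to+\infty}\frac{g(s)}{s}=+\infty,\qquad \limsup_{s\to0^{+}}\frac{k(s)}{s}<+\infty.$$ Then there exists $\mu^{*}>0$ such that for every $\mu>\mu^{*}$ the boundary value problem $$u''+a(x)g(u)-\mu\, b(x)k(u)=0,\qquad \alpha u(0)-\beta u'(0)=0,\qquad \gamma u(L)+\delta u'(L)=0$$ has at least $3$ positive solutions.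
   Context: A solution is a function $u\colon[0,L]\to[0,+\infty)$ such that $u$ and $u'$ are absolutely continuous, the differential equation holds for a.e. $x\in[0,L]$, and the boundary conditions hold. A solution is called positive if $u(x)>0$ for every $x\in\,]0,L[$. *)

(* Defs.v *)
From Stdlib Require Import Reals Lra Lia.
Open Scope R_scope.

Fixpoint fsum (n : nat) (f : nat -> R) : R :=
  match n with
  | O => 0
  | S m => fsum m f + f m
  end.

Definition cont_on (D : R -> Prop) (f : R -> R) : Prop :=
  forall x, D x -> forall eps, 0 < eps -> exists del, 0 < del /\
    forall y, D y -> Rabs (y - x) < del -> Rabs (f y - f x) < eps.

Definition in0L (L x : R) : Prop := 0 <= x <= L.

Definition has_deriv_in (L : R) (f : R -> R) (x l : R) : Prop :=
  forall eps, 0 < eps -> exists del, 0 < del /\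
    forall h, h <> 0 -> Rabs h < del -> 0 <= x + h <= L ->
      Rabs ((f (x + h) - f x) / h - l) < eps.

Definition abs_cont_on (L : R) (f : R -> R) : Prop :=
  forall eps, 0 < eps -> exists del, 0 < del /\
    forall (n : nat) (s t : nat -> R),
      (forall i, (i < n)%nat -> 0 <= s i <= t i /\ t i <= L) ->
      (forall i j, (i < j)%nat -> (j < n)%nat -> t i <= s j) ->
      fsum n (fun i => t i - s i) < del ->
      fsum n (fun i => Rabs (f (t i) - f (s i))) < eps.

Definition negligible (N : R -> Prop) : Prop :=
  forall eps, 0 < eps -> exists c d : nat -> R,
    (forall i, c i <= d i) /\
    (forall x, N x -> exists i, c i < x < d i) /\
    (forall n, fsum n (fun i => d i - c i) <= eps).

Definition ae_on (L : R) (P : R -> Prop) : Prop :=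
  exists N, negligible N /\ forall x, in0L L x -> ~ N x -> P x.

(* (u, du) is a solution of
     u'' + a(x) g(u) - mu b(x) k(u) = 0,
     alpha u(0) - beta u'(0) = 0,  gamma u(L) + delta u'(L) = 0,
   in the Caratheodory sense: u : [0,L] -> [0,+oo), u and u' = du
   absolutely continuous, equation a.e. *)
Definition is_solution (L alpha beta gamma delta mu : R)
    (a b g k : R -> R) (u du : R -> R) : Prop :=
  (forall x, in0L L x -> 0 <= u x) /\
  abs_cont_on L u /\
  abs_cont_on L du /\
  (forall x, in0L L x -> has_deriv_in L u x (du x)) /\
  ae_on L (fun x => has_deriv_in L du x (- (a x * g (u x)) + mu * b x * k (u x))) /\
  alpha * u 0 - beta * du 0 = 0 /\
  gamma * u L + delta * du L = 0.

Definition is_positive_solution (L alpha beta gamma delta mu : R)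
    (a b g k : R -> R) (u : R -> R) : Prop :=
  (exists du, is_solution L alpha beta gamma delta mu a b g k u du) /\
  (forall x, 0 < x < L -> 0 < u x).

Definition differ_on (L : R) (u v : R -> R) : Prop :=
  exists x, in0L L x /\ u x <> v x.

(* Main.v *)
Require Import Defs.
From Stdlib Require Import Reals Lra Lia Classical ClassicalEpsilon.
From Coquelicot Require Import Coquelicot.
From mathcomp.classical Require filter.
Open Scope R_scope.

(* Shooting from [x = 0] along the boundary condition: [u 0 = beta s], [u' 0 = alpha s].
   Put [F = gamma u L + delta u' L] and [Phi = max (u sigma) (u' sigma)].  The zeros of [F]
   with [s > 0] are the positive solutions.  For a suitable small [r], and [mu] large:
   - at one fixed small parameter [ss], [u] stays away from 0 on [[tau, sigma]], so the
     factor [mu] makes it huge at [sigma] and superlinearity forces [F < 0];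
   - at a fixed large parameter [S], [u] vanishes before [tau], so [F < 0] and [Phi < 0];
   - whenever [Phi = r], convexity and the a priori bound on [[0, tau]] bound
     [u' sigma] below by a fixed multiple of [r], so [u] is small and increasing on [[sigma, L]] and [F > 0].
   As [Phi] is 0, large, negative at 0, [ss], [S], the intermediate value theorem for
   [max F (+- (Phi - r))] gives zeros of [F] with [s < ss, Phi > r], with
   [s > ss, Phi > r] and with [s > ss, Phi < r]. *)

(** * Calculus on the interval *)

(** Two obstacles shape the argument. The nonlinearities are merely continuous, so an initial value
    problem may have several solutions, and [F] and [Phi] are not functions of [s]. Every sign
    statement is therefore proved for all solutions with a given parameter, and intermediate values
    are taken on Euler polygons. Moreover nothing restricts the growth of [k] at infinity, so [k] is
    frozen beyond a level [K]. This is not circular: [b] vanishes on [0, tau] and [sigma, L], so the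
    superlinear bound on nonnegative solutions there depends on [a] and [g] only, neither on [mu]
    nor on what replaces [k], and convexity carries it across [tau, sigma]. Hence [K] can be fixed
    before [mu]. Below 0 both nonlinearities are extended by 0: a solution with [s > 0] that reaches
    0 inside the interval goes on as a decreasing straight line and ends with [F < 0]. This is what
    makes the zeros of [F] positive solutions. The set [Phi = r] acts as a barrier on which [F > 0],
    so that zeros of [F] on its two sides can be found separately. *)

Definition clamp (L x : R) : R := Rmax 0 (Rmin x L).

Lemma clamp_in (L x : R) : 0 <= L -> 0 <= clamp L x <= L.
Proof.
intro HL; unfold clamp, Rmax, Rmin.
destruct (Rle_dec x L); destruct (Rle_dec 0 _); lra.
Qed.

Lemma clamp_id (L x : R) : 0 <= x <= L -> clamp L x = x.
Proof.
intro Hx; unfold clamp; rewrite Rmin_left by lra; apply Rmax_right; lra.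
Qed.

Lemma clamp_lip (L x y : R) : 0 <= L -> Rabs (clamp L x - clamp L y) <= Rabs (x - y).
Proof.
intro HL; unfold clamp, Rmax, Rmin, Rabs.
repeat (destruct (Rle_dec _ _) || destruct (Rcase_abs _)); lra.
Qed.

(** Extends a function given on the interval continuously to the whole line, the form in which the
    extreme value and mean value theorems are applied below. The same retraction later truncates [g]
    and [k]. *)
Lemma clamp_continuity (L : R) (f : R -> R) : 0 <= L -> cont_on (in0L L) f ->
  continuity (fun x => f (clamp L x)).
Proof.
intros HL Hf x eps Heps.
destruct (Hf (clamp L x) (clamp_in L x HL) eps Heps) as [d [Hd H]].
exists d; split; [exact Hd|].
intros y [_ Hy]; apply H; [apply clamp_in; exact HL|].
eapply Rle_lt_trans; [apply clamp_lip; exact HL|exact Hy].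
Qed.

Lemma has_deriv_in_le (L : R) (f : R -> R) (x l eps : R) : 0 <= x <= L ->
  has_deriv_in L f x l -> 0 < eps -> exists del, 0 < del /\
    forall y, 0 <= y <= L -> Rabs (y - x) < del ->
      Rabs (f y - f x - l * (y - x)) <= eps * Rabs (y - x).
Proof.
intros Hx Hf Heps.
destruct (Hf eps Heps) as [d [Hd H]].
exists d; split; [exact Hd|]; intros y Hy Hyx.
destruct (Req_dec y x) as [->|Hne].
{ replace (f x - f x - l * (x - x)) with 0 by ring.
  rewrite Rabs_R0; apply Rmult_le_pos; [lra|apply Rabs_pos]. }
assert (Hh : y - x <> 0) by lra.
specialize (H (y - x) Hh Hyx).
replace (x + (y - x)) with y in H by ring.
specialize (H Hy).
replace (f y - f x - l * (y - x)) with (((f y - f x) / (y - x) - l) * (y - x))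
  by (field; exact Hh).
rewrite Rabs_mult; apply Rmult_le_compat_r; [apply Rabs_pos|lra].
Qed.

Lemma has_deriv_in_cont (L : R) (f df : R -> R) :
  (forall x, in0L L x -> has_deriv_in L f x (df x)) -> cont_on (in0L L) f.
Proof.
intros Hf x Hx eps Heps.
destruct (has_deriv_in_le L f x (df x) 1 Hx (Hf x Hx) Rlt_0_1) as [d [Hd H]].
assert (HK : 0 < Rabs (df x) + 2) by (pose proof (Rabs_pos (df x)); lra).
exists (Rmin d (eps / (Rabs (df x) + 2))); split.
{ apply Rmin_pos; [exact Hd|]; apply Rdiv_lt_0_compat; lra. }
intros y Hy Hyx.
assert (H1 : Rabs (y - x) < d) by (eapply Rlt_le_trans; [exact Hyx|apply Rmin_l]).
assert (H2 : Rabs (y - x) < eps / (Rabs (df x) + 2))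
  by (eapply Rlt_le_trans; [exact Hyx|apply Rmin_r]).
apply Rlt_div_r in H2; [|exact HK].
specialize (H y Hy H1).
replace (f y - f x) with ((f y - f x - df x * (y - x)) + df x * (y - x)) by ring.
eapply Rle_lt_trans; [apply Rabs_triang|]; rewrite (Rabs_mult (df x)).
pose proof (Rabs_pos (y - x)); nra.
Qed.

Lemma has_deriv_in_is_derive (L : R) (f : R -> R) (x l : R) : 0 < x < L ->
  has_deriv_in L f x l -> is_derive f x l.
Proof.
intros Hx Hf; apply is_derive_Reals; intros eps Heps.
destruct (Hf eps Heps) as [d [Hd H]].
assert (Hm : 0 < Rmin d (Rmin x (L - x))) by (repeat apply Rmin_pos; lra).
exists (mkposreal _ Hm); intros h Hh Hhd; simpl in Hhd.
pose proof (Rmin_l d (Rmin x (L - x))); pose proof (Rmin_r d (Rmin x (L - x))).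
pose proof (Rmin_l x (L - x)); pose proof (Rmin_r x (L - x)).
apply H; [exact Hh|lra|].
revert Hhd; unfold Rabs; destruct (Rcase_abs h); lra.
Qed.

(** The clamped function coincides with [f] near every interior point, hence is differentiable
    there, and it does not see the values of [f] outside [0, L]. *)
Lemma mvt_open (L : R) (f df : R -> R) (x y : R) :
  continuity (fun t => f (clamp L t)) -> (forall c, 0 < c < L -> is_derive f c (df c)) ->
  0 <= x -> x < y -> y <= L -> exists c, x <= c <= y /\ f y - f x = df c * (y - x).
Proof.
intros Hc Hd Hx Hxy Hy.
destruct (MVT_gen (fun t => f (clamp L t)) x y df) as [c [Hc1 Hc2]].
- rewrite Rmin_left, Rmax_right by lra; intros t Ht.
  apply is_derive_ext_loc with f; [|apply Hd; lra].
  assert (He : 0 < Rmin t (L - t)) by (apply Rmin_pos; lra).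
  exists (mkposreal _ He); intros z Hz.
  change (Rabs (z - t) < Rmin t (L - t)) in Hz.
  pose proof (Rmin_l t (L - t)); pose proof (Rmin_r t (L - t)).
  symmetry; rewrite clamp_id; [reflexivity|].
  revert Hz; unfold Rabs; destruct (Rcase_abs (z - t)); lra.
- intros t _; apply Hc.
- rewrite Rmin_left, Rmax_right in Hc1 by lra.
  exists c; split; [exact Hc1|].
  rewrite !clamp_id in Hc2 by lra; exact Hc2.
Qed.

Lemma mvt_in (L : R) (f df : R -> R) (x y : R) :
  (forall c, in0L L c -> has_deriv_in L f c (df c)) ->
  0 <= x -> x <= y -> y <= L -> exists c, x <= c <= y /\ f y - f x = df c * (y - x).
Proof.
intros Hd Hx Hxy Hy.
destruct (Req_dec x y) as [->|Hne].
{ exists y; split; [lra|ring]. }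
apply (mvt_open L); try lra.
- apply clamp_continuity; [lra|]; apply has_deriv_in_cont with df; exact Hd.
- intros c Hc; apply has_deriv_in_is_derive with L; [exact Hc|apply Hd; unfold in0L; lra].
Qed.

Lemma deriv_ge (L : R) (f df : R -> R) (x y m : R) :
  (forall c, in0L L c -> has_deriv_in L f c (df c)) ->
  0 <= x -> x <= y -> y <= L -> (forall c, x <= c <= y -> m <= df c) ->
  f x + m * (y - x) <= f y.
Proof.
intros Hd Hx Hxy Hy Hm.
destruct (mvt_in L f df x y Hd Hx Hxy Hy) as [c [Hc H]].
specialize (Hm c Hc); nra.
Qed.

Lemma deriv_le (L : R) (f df : R -> R) (x y m : R) :
  (forall c, in0L L c -> has_deriv_in L f c (df c)) ->
  0 <= x -> x <= y -> y <= L -> (forall c, x <= c <= y -> df c <= m) ->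
  f y <= f x + m * (y - x).
Proof.
intros Hd Hx Hxy Hy Hm.
destruct (mvt_in L f df x y Hd Hx Hxy Hy) as [c [Hc H]].
specialize (Hm c Hc); nra.
Qed.

Lemma cont_on_bounded (L : R) (f : R -> R) : 0 <= L -> cont_on (in0L L) f ->
  exists B, 0 < B /\ forall x, in0L L x -> Rabs (f x) <= B.
Proof.
intros HL Hf.
pose proof (clamp_continuity L f HL Hf) as Hc.
destruct (continuity_ab_maj _ 0 L HL (fun c _ => Hc c)) as [M [HM _]].
destruct (continuity_ab_min _ 0 L HL (fun c _ => Hc c)) as [m [Hm _]].
exists (1 + Rabs (f (clamp L M)) + Rabs (f (clamp L m))).
pose proof (Rabs_pos (f (clamp L M))); pose proof (Rabs_pos (f (clamp L m))).
split; [lra|]; intros x Hx.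
specialize (HM x Hx); specialize (Hm x Hx); rewrite (clamp_id L x Hx) in HM, Hm.
revert HM Hm; unfold Rabs.
repeat destruct (Rcase_abs _); lra.
Qed.

Lemma cont_on_pos_min (D : R -> Prop) (f : R -> R) (x y : R) :
  x <= y -> (forall t, x <= t <= y -> D t) -> cont_on D f ->
  (forall t, x <= t <= y -> 0 < f t) ->
  exists m, 0 < m /\ forall t, x <= t <= y -> m <= f t.
Proof.
intros Hxy HD Hf Hpos.
set (F := fun t => f (x + clamp (y - x) (t - x))).
assert (Hin : forall t, x <= x + clamp (y - x) t <= y)
  by (intro t; pose proof (clamp_in (y - x) t); lra).
assert (HF : continuity F).
{ intros t eps Heps.
  destruct (Hf _ (HD _ (Hin (t - x))) eps Heps) as [d [Hd H]].
  exists d; split; [exact Hd|]; intros z [_ Hz].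
  apply H; [apply HD, Hin|].
  pose proof (clamp_lip (y - x) (z - x) (t - x) ltac:(lra)) as Hl.
  change (Rabs (z - t) < d) in Hz.
  replace (z - x - (t - x)) with (z - t) in Hl by ring.
  replace (x + clamp (y - x) (z - x) - (x + clamp (y - x) (t - x)))
    with (clamp (y - x) (z - x) - clamp (y - x) (t - x)) by ring.
  lra. }
destruct (continuity_ab_min F x y Hxy (fun c _ => HF c)) as [m [Hm Hmi]].
exists (F m); split; [apply Hpos, Hin|].
intros t Ht; specialize (Hm t Ht); unfold F in Hm at 2.
rewrite clamp_id in Hm by lra.
replace (x + (t - x)) with t in Hm by ring; exact Hm.
Qed.

(** * Euler polygons and their ultrafilter limits *)

(** A free ultrafilter, recast as a plain predicate. Along it every bounded real sequence converges,
    so limits of the polygons exist at all abscissas at once, with no extraction of subsequences. *)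
Lemma ultrafilter_nat : exists W : (nat -> Prop) -> Prop,
  (forall P Q : nat -> Prop, (forall n, P n -> Q n) -> W P -> W Q) /\
  (forall P Q, W P -> W Q -> W (fun n => P n /\ Q n)) /\
  (forall P, W P -> exists n, P n) /\
  (forall P, ~ W P -> W (fun n => ~ P n)) /\
  (forall N, W (fun n => (N <= n)%nat)).
Proof.
destruct (filter.ultraFilterLemma filter.eventually_filter) as [W [HU Hle]].
exists W.
pose proof (@filter.ultra_proper _ _ HU) as HP.
pose proof (@filter.filter_filter _ _ HP) as HF.
assert (Hmono : forall P Q : nat -> Prop, (forall n, P n -> Q n) -> W P -> W Q).
{ intros P Q H; apply (@filter.filterS _ _ HF); exact H. }
split; [exact Hmono|].
split; [intros P Q HPp HQ; exact (@filter.filterI _ _ HF _ _ HPp HQ)|].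
assert (Hex : forall P, W P -> exists n, P n).
{ intros P H; apply NNPP; intro Hn.
  apply (@filter.filter_not_empty _ _ HP).
  apply (Hmono P); [|exact H].
  intros n Pn; apply Hn; exists n; exact Pn. }
split; [exact Hex|].
split.
- intros P HnP.
  destruct (filter.in_ultra_setVsetC P HU) as [H|H]; [contradiction|exact H].
- intro N; apply Hle; exists N; [exact I|].
  intros n Hn; apply (ssrbool.elimT ssrnat.leP); exact Hn.
Qed.

Definition ivp (L alpha beta : R) (f : R -> R -> R) (s : R) (u p : R -> R) : Prop :=
  (forall x, in0L L x -> has_deriv_in L u x (p x)) /\
  (forall x, in0L L x -> has_deriv_in L p x (f x (u x))) /\
  u 0 = beta * s /\ p 0 = alpha * s.

Fixpoint euler (f : R -> R -> R) (h w0 p0 : R) (n : nat) : R * R :=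
  match n with
  | O => (w0, p0)
  | S m => let wp := euler f h w0 p0 m in
           (fst wp + h * snd wp, snd wp + h * f (INR m * h) (fst wp))
  end.

(** Discrete mean value inequality, by induction on the upper index: the increment differs from that
    of slope [v] by at most [e] times the elapsed time. *)
Lemma step_bound (h v e : R) (z phi : nat -> R) (i j : nat) : 0 <= h ->
  (forall m, z (S m) = z m + h * phi m) -> (i <= j)%nat ->
  (forall m, (i <= m < j)%nat -> Rabs (phi m - v) <= e) ->
  Rabs (z j - z i - (INR j - INR i) * h * v) <= (INR j - INR i) * h * e.
Proof.
intros Hh Hz Hij; induction Hij as [|j Hij IH]; intro Hphi.
{ replace (z i - z i - (INR i - INR i) * h * v) with 0 by ring.
  rewrite Rabs_R0; lra. }
assert (IH' := IH ltac:(intros m Hm; apply Hphi; lia)).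
assert (Hj := Hphi j ltac:(lia)).
rewrite S_INR, Hz.
replace (z j + h * phi j - z i - (INR j + 1 - INR i) * h * v)
  with ((z j - z i - (INR j - INR i) * h * v) + h * (phi j - v)) by ring.
eapply Rle_trans; [apply Rabs_triang|].
rewrite Rabs_mult, (Rabs_pos_eq h) by exact Hh.
apply (Rmult_le_compat_l h) in Hj; lra.
Qed.

Lemma step_bound_abs (h v e : R) (z phi : nat -> R) (i j : nat) : 0 <= h ->
  (forall m, z (S m) = z m + h * phi m) ->
  (forall m, ((i <= m < j) \/ (j <= m < i))%nat -> Rabs (phi m - v) <= e) ->
  Rabs (z j - z i - (INR j - INR i) * h * v) <= Rabs ((INR j - INR i) * h) * e.
Proof.
intros Hh Hz Hphi.
destruct (Nat.le_ge_cases i j) as [H|H]; pose proof (le_INR _ _ H).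
- rewrite (Rabs_pos_eq ((INR j - INR i) * h)) by (apply Rmult_le_pos; lra).
  apply step_bound with phi; try assumption; intros m Hm; apply Hphi; lia.
- rewrite (Rabs_left1 ((INR j - INR i) * h)) by nra.
  rewrite <- Rabs_Ropp.
  replace (- (z j - z i - (INR j - INR i) * h * v))
    with (z i - z j - (INR i - INR j) * h * v) by ring.
  replace (- ((INR j - INR i) * h) * e) with ((INR i - INR j) * h * e) by ring.
  apply step_bound with phi; try assumption; intros m Hm; apply Hphi; lia.
Qed.

(** * Limits along an ultrafilter *)

Section Ultralimit.

Context (W : (nat -> Prop) -> Prop).
Context (Wmono : forall P Q : nat -> Prop, (forall n, P n -> Q n) -> W P -> W Q).
Context (Wand : forall P Q, W P -> W Q -> W (fun n => P n /\ Q n)).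
Context (Wex : forall P, W P -> exists n, P n).
Context (Wneg : forall P, ~ W P -> W (fun n => ~ P n)).
Context (Wlarge : forall N, W (fun n => (N <= n)%nat)).

Definition ulim (x : nat -> R) (l : R) : Prop :=
  forall eps, 0 < eps -> W (fun n => Rabs (x n - l) < eps).

(** The limit is the supremum of the levels that [x] reaches for [W]-almost all indices; the
    ultrafilter property turns the failure of the level [l + eps] into an upper bound valid almost
    everywhere. *)
Lemma ulim_ex (C : R) (x : nat -> R) : (forall n, Rabs (x n) <= C) -> exists l, ulim x l.
Proof.
intro HC.
destruct (completeness (fun y => W (fun n => y <= x n))) as [l [Hub Hlub]].
- exists C; intros y Hy; destruct (Wex _ Hy) as [n Hn].
  specialize (HC n); pose proof (Rle_abs (x n)); lra.
- exists (- C); apply Wmono with (fun n => (0 <= n)%nat); [|apply Wlarge].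
  intros n _; specialize (HC n); pose proof (Rle_abs (- x n)); rewrite Rabs_Ropp in *; lra.
- exists l; intros eps Heps.
  assert (H1 : W (fun n => ~ l + eps <= x n)).
  { apply Wneg; intro H; specialize (Hub _ H); lra. }
  assert (H2 : exists y, W (fun n => y <= x n) /\ l - eps < y).
  { apply NNPP; intro Hn.
    assert (l <= l - eps); [|lra].
    apply Hlub; intros y Hy; apply Rnot_lt_le; intro Hlt; apply Hn; exists y; tauto. }
  destruct H2 as [y [Hy Hly]].
  apply Wmono with (2 := Wand _ _ H1 Hy); intros n [Ha Hb].
  apply Rabs_lt_between; lra.
Qed.

Lemma ulim_le (x : nat -> R) (l c : R) : ulim x l -> W (fun n => x n <= c) -> l <= c.
Proof.
intros Hx Hc; apply Rnot_lt_le; intro Hlt.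
destruct (Wex _ (Wand _ _ (Hx (l - c) ltac:(lra)) Hc)) as [n [H1 H2]].
apply Rabs_lt_between in H1; lra.
Qed.

Lemma ulim_ge (x : nat -> R) (l c : R) : ulim x l -> W (fun n => c <= x n) -> c <= l.
Proof.
intros Hx Hc; apply Rnot_lt_le; intro Hlt.
destruct (Wex _ (Wand _ _ (Hx (c - l) ltac:(lra)) Hc)) as [n [H1 H2]].
apply Rabs_lt_between in H1; lra.
Qed.

Lemma ulim_scal (x : nat -> R) (l c : R) : ulim x l -> ulim (fun n => c * x n) (c * l).
Proof.
intros Hx eps Heps.
assert (HK : 0 < Rabs c + 1) by (pose proof (Rabs_pos c); lra).
apply Wmono with (2 := Hx (eps / (Rabs c + 1)) ltac:(apply Rdiv_lt_0_compat; lra)).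
intros n Hn; apply Rlt_div_r in Hn; [|exact HK].
replace (c * x n - c * l) with (c * (x n - l)) by ring.
rewrite Rabs_mult; pose proof (Rabs_pos (x n - l)); pose proof (Rabs_pos c); nra.
Qed.

Lemma ulim_unique (x : nat -> R) (l l' : R) : ulim x l -> ulim x l' -> l = l'.
Proof.
intros H H'; apply Rle_antisym; apply Rnot_lt_le; intro Hlt.
- destruct (Wex _ (Wand _ _ (H ((l - l') / 2) ltac:(lra)) (H' ((l - l') / 2) ltac:(lra))))
    as [n [H1 H2]]; apply Rabs_lt_between in H1; apply Rabs_lt_between in H2; lra.
- destruct (Wex _ (Wand _ _ (H ((l' - l) / 2) ltac:(lra)) (H' ((l' - l) / 2) ltac:(lra))))
    as [n [H1 H2]]; apply Rabs_lt_between in H1; apply Rabs_lt_between in H2; lra.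
Qed.

(** * Grids on the interval and derivatives of limit functions *)

Context (L : R) (HL : 0 < L).

Let h (n : nat) : R := L / INR (S n).

Lemma mesh_pos (n : nat) : 0 < h n.
Proof. apply Rdiv_lt_0_compat; [exact HL|apply lt_0_INR; lia]. Qed.

Lemma mesh_small (eps : R) : 0 < eps -> W (fun n => h n < eps).
Proof.
intro Heps.
destruct (nfloor_ex (L / eps)) as [N HN].
{ apply Rlt_le, Rdiv_lt_0_compat; lra. }
apply Wmono with (2 := Wlarge N); intros n Hn.
apply le_INR in Hn; unfold h; rewrite S_INR.
apply Rlt_div_l; [pose proof (pos_INR n); lra|].
assert (H : L / eps < INR n + 1) by lra.
apply Rlt_div_l in H; lra.
Qed.

(** The integer part of [x / h n], that is the index of the last grid point not beyond [x];
    meaningful for [0 <= x]. *)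
Definition idx (n : nat) (x : R) : nat :=
  epsilon (inhabits O) (fun i => INR i * h n <= x < (INR i + 1) * h n).

Lemma idx_spec (n : nat) (x : R) : 0 <= x ->
  INR (idx n x) * h n <= x < (INR (idx n x) + 1) * h n.
Proof.
intro Hx; unfold idx; apply epsilon_spec.
pose proof (mesh_pos n) as Hh.
destruct (nfloor_ex (x / h n)) as [i Hi].
{ apply Rdiv_le_0_compat; lra. }
exists i; split.
- apply Rle_div_r; [exact Hh|lra].
- apply Rlt_div_l; [exact Hh|lra].
Qed.

Lemma idx_0 (n : nat) : idx n 0 = O.
Proof.
pose proof (mesh_pos n) as Hh.
destruct (idx_spec n 0 (Rle_refl 0)) as [H _].
destruct (idx n 0) as [|i]; [reflexivity|].
rewrite S_INR in H; pose proof (pos_INR i); nra.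
Qed.

(** The discrete mean value inequality holds between the grid points next to [x] and [x + k], and a
    violation by the limit function would already be visible at a single well chosen index [n]. *)
Lemma ulim_has_deriv (zs phis : nat -> nat -> R) (z : R -> R) (x v : R) :
  (forall n m, zs n (S m) = zs n m + h n * phis n m) ->
  (forall y, in0L L y -> ulim (fun n => zs n (idx n y)) (z y)) ->
  in0L L x ->
  (forall eps, 0 < eps -> exists del, 0 < del /\
     W (fun n => forall m, Rabs (INR m * h n - x) < del -> Rabs (phis n m - v) < eps)) ->
  has_deriv_in L z x v.
Proof.
intros Hstep Hz Hx Hphi eps Heps.
destruct (Hphi (eps / 2) ltac:(lra)) as [d [Hd HW]].
exists (d / 2); split; [lra|]; intros k Hk Hkd Hy.
assert (Hmain : Rabs (z (x + k) - z x - k * v) <= Rabs k * (eps / 2)).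
{ apply Rnot_lt_le; intro Hlt.
  set (eta := Rabs (z (x + k) - z x - k * v) - Rabs k * (eps / 2)) in *.
  assert (Heta : 0 < eta) by (unfold eta; lra).
  (* With a mesh below this, passing from [k] to the distance [D] of grid points costs at most
     [h n * (Rabs v + eps / 2)], less than [eta / 4]; the two values cost [eta / 8] each, so the
     total stays below [eta]. *)
  assert (Hq : 0 < eta / 4 / (Rabs v + eps)).
  { apply Rdiv_lt_0_compat; [lra|]; pose proof (Rabs_pos v); lra. }
  destruct (Wex _ (Wand _ _ (Wand _ _ (Hz _ Hy (eta / 8) ltac:(lra))
     (Hz _ Hx (eta / 8) ltac:(lra)))
     (Wand _ _ HW (Wand _ _ (mesh_small (d / 2) ltac:(lra)) (mesh_small _ Hq)))))
    as [n [[H1 H2] [H3 [H4 H5]]]].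
  apply Rlt_div_r in H5; [|pose proof (Rabs_pos v); lra].
  pose proof (mesh_pos n) as Hh.
  destruct (idx_spec n (x + k) (proj1 Hy)) as [Ha Hb].
  destruct (idx_spec n x (proj1 Hx)) as [Hc He].
  set (i := idx n x) in *; set (j := idx n (x + k)) in *.
  assert (Hs := step_bound_abs (h n) v (eps / 2) (zs n) (phis n) i j
    (Rlt_le _ _ Hh) (Hstep n)).
  assert (Hm : forall m, (i <= m < j \/ j <= m < i)%nat -> Rabs (phis n m - v) <= eps / 2).
  { intros m Hm; apply Rlt_le, H3.
    (* The grid points visited lie at most one mesh width outside the segment from [x] to [x + k],
       and [Rabs k] and [h n] are both below [d / 2]. *)
    assert (Hr : (INR m * h n <= x + k /\ x - h n < INR m * h n) \/
                 (INR m * h n <= x /\ x + k - h n < INR m * h n)).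
    { destruct Hm as [[Hm1 Hm2]|[Hm1 Hm2]]; apply le_INR in Hm1; apply le_INR in Hm2;
        rewrite S_INR in Hm2; [left|right]; split; nra. }
    revert Hkd; unfold Rabs; repeat destruct (Rcase_abs _); lra. }
  specialize (Hs Hm).
  set (D := (INR j - INR i) * h n) in *.
  assert (HD : Rabs (D - k) <= h n).
  { unfold D; apply Rabs_le_between; split; nra. }
  assert (HDk : Rabs D <= Rabs k + h n).
  { replace D with (k + (D - k)) by ring.
    eapply Rle_trans; [apply Rabs_triang|]; lra. }
  assert (Htri : Rabs (z (x + k) - z x - k * v) <=
     Rabs (zs n j - zs n i - D * v) + Rabs (zs n j - z (x + k)) + Rabs (zs n i - z x)
     + Rabs (D - k) * Rabs v).
  { rewrite <- Rabs_mult.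
    replace (z (x + k) - z x - k * v) with
      ((zs n j - zs n i - D * v) - (zs n j - z (x + k)) + (zs n i - z x) + (D - k) * v) by ring.
    eapply Rle_trans; [apply Rabs_triang|]; apply Rplus_le_compat_r.
    eapply Rle_trans; [apply Rabs_triang|]; apply Rplus_le_compat_r.
    unfold Rminus at 1; eapply Rle_trans; [apply Rabs_triang|].
    rewrite Rabs_Ropp; lra. }
  pose proof (Rabs_pos v).
  assert (Rabs (D - k) * Rabs v <= h n * Rabs v) by (apply Rmult_le_compat_r; lra).
  assert (Rabs D * (eps / 2) <= (Rabs k + h n) * (eps / 2)) by (apply Rmult_le_compat_r; lra).
  unfold eta in *; nra. }
replace ((z (x + k) - z x) / k - v) with ((z (x + k) - z x - k * v) / k) by (field; exact Hk).
unfold Rdiv at 1; rewrite Rabs_mult, Rabs_inv.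
assert (Hk' : 0 < Rabs k) by (apply Rabs_pos_lt; exact Hk).
apply Rlt_div_l; [exact Hk'|]; nra.
Qed.

(** Equicontinuity: a common Lipschitz constant extends convergence at the single grid point next to
    [x] to all grid points in a neighbourhood. The bound [L + 1] leaves room for grid points beyond
    [L]. *)
Lemma ulim_near (zs : nat -> nat -> R) (x z P d : R) :
  0 <= x <= L -> 0 <= P -> 0 < d ->
  (forall n m i, INR m * h n <= L + 1 -> INR i * h n <= L + 1 ->
     Rabs (zs n m - zs n i) <= P * Rabs (INR m * h n - INR i * h n)) ->
  ulim (fun n => zs n (idx n x)) z ->
  exists del, 0 < del /\ W (fun n => forall m, Rabs (INR m * h n - x) < del ->
    Rabs (zs n m - z) < d /\ Rabs (INR m * h n - x) < d).
Proof.
intros Hx HP Hd Hlip Hz.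
(* The bound 1 keeps the grid points below [L + 1]; the last entry makes [P * (2 * del)] at most
   [d / 2]. *)
set (del := Rmin 1 (Rmin d (d / (4 * (P + 1))))).
assert (H1 : del <= 1) by apply Rmin_l.
assert (H2 : del <= d) by (eapply Rle_trans; [apply Rmin_r|apply Rmin_l]).
assert (H3 : del <= d / (4 * (P + 1))) by (eapply Rle_trans; [apply Rmin_r|apply Rmin_r]).
apply Rle_div_r in H3; [|lra].
assert (Hdel : 0 < del).
{ repeat apply Rmin_pos; try lra; apply Rdiv_lt_0_compat; lra. }
exists del; split; [exact Hdel|].
apply Wmono with (2 := Wand _ _ (mesh_small del Hdel) (Hz (d / 2) ltac:(lra))).
intros n [Hh Hzn] m Hm; split; [|lra].
pose proof (mesh_pos n) as Hh0.
destruct (idx_spec n x (proj1 Hx)) as [Ha Hb].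
set (i := idx n x) in *.
apply Rabs_lt_between in Hm.
assert (Hl := Hlip n m i ltac:(lra) ltac:(lra)).
assert (Hr : Rabs (INR m * h n - INR i * h n) <= 2 * del) by (apply Rabs_le_between; lra).
replace (zs n m - z) with ((zs n m - zs n i) + (zs n i - z)) by ring.
eapply Rle_lt_trans; [apply Rabs_triang|].
assert (P * Rabs (INR m * h n - INR i * h n) <= P * (2 * del)) by (apply Rmult_le_compat_l; lra).
nra.
Qed.

(** * Estimates on the polygons and their limits *)

Context (alpha beta Bf : R) (f : R -> R -> R).
Context (Hfb : forall x u, Rabs (f x u) <= Bf).
Context (Hfc : forall x u eps, 0 < eps -> exists del, 0 < del /\
  forall x' u', Rabs (x' - x) < del -> Rabs (u' - u) < del -> Rabs (f x' u' - f x u) < eps).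

Definition approx (n : nat) (s : R) (i : nat) : R * R :=
  euler f (h n) (beta * s) (alpha * s) i.

Lemma approx_snd_lip (n : nat) (s : R) (m i : nat) :
  Rabs (snd (approx n s m) - snd (approx n s i)) <= Bf * Rabs (INR m * h n - INR i * h n).
Proof.
assert (H := step_bound_abs (h n) 0 Bf (fun m => snd (approx n s m))
  (fun m => f (INR m * h n) (fst (approx n s m))) i m (Rlt_le _ _ (mesh_pos n))
  (fun m => eq_refl)).
simpl in H; rewrite <- Rmult_minus_distr_r, Rmult_comm.
rewrite Rmult_0_r, Rminus_0_r in H; apply H.
intros m' _; rewrite Rminus_0_r; apply Hfb.
Qed.

Lemma approx_snd_bound (n : nat) (s : R) (i : nat) : INR i * h n <= L + 1 ->
  Rabs (snd (approx n s i)) <= Rabs (alpha * s) + Bf * (L + 1).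
Proof.
intro Hi; pose proof (approx_snd_lip n s i O) as H; simpl in H.
pose proof (mesh_pos n); pose proof (pos_INR i).
assert (0 <= INR i * h n) by (apply Rmult_le_pos; lra).
rewrite Rmult_0_l, Rminus_0_r, (Rabs_pos_eq (INR i * h n)) in H by assumption.
pose proof (Rle_trans _ _ _ (Rabs_pos _) (Hfb 0 0)).
replace (snd (approx n s i)) with ((snd (approx n s i) - alpha * s) + alpha * s) by ring.
eapply Rle_trans; [apply Rabs_triang|].
assert (Bf * (INR i * h n) <= Bf * (L + 1)) by (apply Rmult_le_compat_l; lra).
lra.
Qed.

Lemma approx_fst_lip (n : nat) (s : R) (m i : nat) :
  INR m * h n <= L + 1 -> INR i * h n <= L + 1 ->
  Rabs (fst (approx n s m) - fst (approx n s i)) <=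
    (Rabs (alpha * s) + Bf * (L + 1)) * Rabs (INR m * h n - INR i * h n).
Proof.
intros Hm Hi.
assert (H := step_bound_abs (h n) 0 (Rabs (alpha * s) + Bf * (L + 1))
  (fun m => fst (approx n s m)) (fun m => snd (approx n s m)) i m
  (Rlt_le _ _ (mesh_pos n)) (fun m => eq_refl)).
simpl in H; rewrite <- Rmult_minus_distr_r, Rmult_comm.
rewrite Rmult_0_r, Rminus_0_r in H; apply H.
intros m' Hm'; rewrite Rminus_0_r; apply approx_snd_bound.
pose proof (mesh_pos n).
destruct Hm' as [[_ H1]|[_ H1]]; apply lt_INR in H1; nra.
Qed.

Lemma approx_fst_bound (n : nat) (s : R) (i : nat) : INR i * h n <= L + 1 ->
  Rabs (fst (approx n s i)) <=
    Rabs (beta * s) + (Rabs (alpha * s) + Bf * (L + 1)) * (L + 1).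
Proof.
intro Hi; pose proof (mesh_pos n); pose proof (pos_INR i).
assert (0 <= INR i * h n) by (apply Rmult_le_pos; lra).
pose proof (approx_fst_lip n s i O Hi ltac:(simpl; lra)) as H'; simpl in H'.
rewrite Rmult_0_l, Rminus_0_r, (Rabs_pos_eq (INR i * h n)) in H' by assumption.
pose proof (Rle_trans _ _ _ (Rabs_pos _) (Hfb 0 0)).
pose proof (Rabs_pos (alpha * s)).
replace (fst (approx n s i)) with ((fst (approx n s i) - beta * s) + beta * s) by ring.
eapply Rle_trans; [apply Rabs_triang|].
assert (0 <= Bf * (L + 1)) by (apply Rmult_le_pos; lra).
assert ((Rabs (alpha * s) + Bf * (L + 1)) * (INR i * h n) <=
  (Rabs (alpha * s) + Bf * (L + 1)) * (L + 1)) by (apply Rmult_le_compat_l; lra).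
lra.
Qed.

(** Peano existence and compactness in the initial parameter at once: the polygons start from
    varying parameters in a compact interval, and their limit along [W] solves the problem with the
    limit parameter. A constant sequence gives plain existence. *)
Lemma ivp_compact (lo hi : R) (sn : nat -> R) : (forall n, lo <= sn n <= hi) ->
  exists s u p, lo <= s <= hi /\ ivp L alpha beta f s u p /\
    forall x, in0L L x ->
      ulim (fun n => fst (approx n (sn n) (idx n x))) (u x) /\
      ulim (fun n => snd (approx n (sn n) (idx n x))) (p x).
Proof.
intro Hsn.
set (C := Rabs lo + Rabs hi).
assert (HC : forall n, Rabs (sn n) <= C).
{ intro n; specialize (Hsn n); unfold C, Rabs; repeat destruct (Rcase_abs _); lra. }
assert (Hcs : forall c n, Rabs (c * sn n) <= Rabs c * C).
{ intros c n; rewrite Rabs_mult; apply Rmult_le_compat_l; [apply Rabs_pos|apply HC]. }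
pose proof (Rle_trans _ _ _ (Rabs_pos _) (Hfb 0 0)) as HBf.
set (P := Rabs alpha * C + Bf * (L + 1)).
assert (HPn : forall n, Rabs (alpha * sn n) + Bf * (L + 1) <= P)
  by (intro n; pose proof (Hcs alpha n); unfold P; lra).
assert (HP : 0 <= P).
{ pose proof (HPn O); pose proof (Rabs_pos (alpha * sn O)).
  assert (0 <= Bf * (L + 1)) by (apply Rmult_le_pos; lra); lra. }
assert (Hidx : forall n x, in0L L x -> INR (idx n x) * h n <= L + 1).
{ intros n x Hx; destruct (idx_spec n x (proj1 Hx)) as [H _]; destruct Hx; lra. }
destruct (ulim_ex C sn HC) as [s Hs].
(* The implication sits under the quantifier to make the choice of limits total in [x]. *)
assert (Hu : forall x, exists l, in0L L x -> ulim (fun n => fst (approx n (sn n) (idx n x))) l).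
{ intro x; destruct (classic (in0L L x)) as [Hx|Hx]; [|exists 0; tauto].
  destruct (ulim_ex (Rabs beta * C + P * (L + 1))
    (fun n => fst (approx n (sn n) (idx n x)))) as [l Hl].
  { intro n; pose proof (approx_fst_bound n (sn n) (idx n x) (Hidx n x Hx)).
    pose proof (Hcs beta n); pose proof (HPn n).
    assert ((Rabs (alpha * sn n) + Bf * (L + 1)) * (L + 1) <= P * (L + 1))
      by (apply Rmult_le_compat_r; lra); lra. }
  exists l; tauto. }
assert (Hp : forall x, exists l, in0L L x -> ulim (fun n => snd (approx n (sn n) (idx n x))) l).
{ intro x; destruct (classic (in0L L x)) as [Hx|Hx]; [|exists 0; tauto].
  destruct (ulim_ex P (fun n => snd (approx n (sn n) (idx n x)))) as [l Hl].
  { intro n; pose proof (approx_snd_bound n (sn n) (idx n x) (Hidx n x Hx)).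
    pose proof (HPn n); lra. }
  exists l; tauto. }
set (u := fun x => epsilon (inhabits 0)
  (fun l => in0L L x -> ulim (fun n => fst (approx n (sn n) (idx n x))) l)).
set (p := fun x => epsilon (inhabits 0)
  (fun l => in0L L x -> ulim (fun n => snd (approx n (sn n) (idx n x))) l)).
assert (Hul : forall x, in0L L x -> ulim (fun n => fst (approx n (sn n) (idx n x))) (u x)).
{ intro x; exact (epsilon_spec (inhabits 0) _ (Hu x)). }
assert (Hpl : forall x, in0L L x -> ulim (fun n => snd (approx n (sn n) (idx n x))) (p x)).
{ intro x; exact (epsilon_spec (inhabits 0) _ (Hp x)). }
assert (H0 : in0L L 0) by (unfold in0L; lra).
exists s, u, p; split; [|split].
- split; [apply (ulim_ge sn)|apply (ulim_le sn)]; try exact Hs;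
    apply Wmono with (2 := Wlarge 0); intros n _; apply Hsn.
- repeat split.
  + intros x Hx.
    apply ulim_has_deriv with (zs := fun n i => fst (approx n (sn n) i))
      (phis := fun n i => snd (approx n (sn n) i)); [reflexivity|exact Hul|exact Hx|].
    intros eps Heps.
    destruct (ulim_near (fun n i => snd (approx n (sn n) i)) x (p x) Bf eps Hx HBf Heps)
      as [d [Hd H]]; [intros; apply approx_snd_lip|apply Hpl, Hx|].
    exists d; split; [exact Hd|]; apply Wmono with (2 := H).
    intros n Hn m Hm; apply (Hn m Hm).
  + intros x Hx.
    apply ulim_has_deriv with (zs := fun n i => snd (approx n (sn n) i))
      (phis := fun n i => f (INR i * h n) (fst (approx n (sn n) i)));
      [reflexivity|exact Hpl|exact Hx|].
    intros eps Heps.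
    destruct (Hfc x (u x) eps Heps) as [e [He Hf]].
    destruct (ulim_near (fun n i => fst (approx n (sn n) i)) x (u x) P e Hx HP He)
      as [d [Hd H]].
    { intros n m i Hm Hi; eapply Rle_trans; [apply approx_fst_lip; assumption|].
      apply Rmult_le_compat_r; [apply Rabs_pos|apply HPn]. }
    { apply Hul, Hx. }
    exists d; split; [exact Hd|]; apply Wmono with (2 := H).
    intros n Hn m Hm; apply Hf; apply (Hn m Hm).
  + apply (ulim_unique (fun n => fst (approx n (sn n) (idx n 0)))); [apply Hul, H0|].
    intros eps Heps; apply Wmono with (2 := ulim_scal sn s beta Hs eps Heps).
    intro n; rewrite idx_0; exact (fun H => H).
  + apply (ulim_unique (fun n => snd (approx n (sn n) (idx n 0)))); [apply Hpl, H0|].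
    intros eps Heps; apply Wmono with (2 := ulim_scal sn s alpha Hs eps Heps).
    intro n; rewrite idx_0; exact (fun H => H).
- intros x Hx; split; [apply Hul, Hx|apply Hpl, Hx].
Qed.

Lemma approx_continuity (n i : nat) :
  continuity (fun s => fst (approx n s i)) /\ continuity (fun s => snd (approx n s i)).
Proof.
induction i as [|i [IH1 IH2]]; simpl.
- split; intro s; reg.
- split.
  + apply continuity_plus; [exact IH1|].
    apply continuity_scal; exact IH2.
  + apply continuity_plus; [exact IH2|].
    apply continuity_scal.
    apply (continuity_comp (fun s => fst (approx n s i)) (f (INR i * h n))); [exact IH1|].
    intros u eps Heps; destruct (Hfc (INR i * h n) u eps Heps) as [d [Hd H]].
    exists d; split; [exact Hd|]; intros u' [_ Hu'].
    apply H; [rewrite Rminus_diag, Rabs_R0; exact Hd|exact Hu'].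
Qed.

(** * Intermediate values of a Lipschitz function of the data at [sg] and [L] *)

Context (sg : R) (Hsg : in0L L sg) (lam : R) (Psi : R -> R -> R -> R -> R).
Context (HPsi : forall a b c d a' b' c' d', Rabs (Psi a b c d - Psi a' b' c' d') <=
  lam * (Rabs (a - a') + Rabs (b - b') + Rabs (c - c') + Rabs (d - d'))).

Let psin (n : nat) (s : R) : R :=
  Psi (fst (approx n s (idx n sg))) (snd (approx n s (idx n sg)))
      (fst (approx n s (idx n L))) (snd (approx n s (idx n L))).

Lemma psin_continuity (n : nat) : continuity (psin n).
Proof.
assert (Hlam : 0 <= lam).
{ pose proof (HPsi 1 0 0 0 0 0 0 0) as H.
  pose proof (Rabs_pos (Psi 1 0 0 0 - Psi 0 0 0 0)).
  rewrite !Rminus_0_r, Rabs_R1, Rabs_R0 in H; lra. }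
intros s eps Heps.
assert (He : eps / (4 * (lam + 1)) > 0) by (apply Rdiv_lt_0_compat; lra).
destruct (proj1 (approx_continuity n (idx n sg)) s _ He) as [d1 [Hd1 H1]].
destruct (proj2 (approx_continuity n (idx n sg)) s _ He) as [d2 [Hd2 H2]].
destruct (proj1 (approx_continuity n (idx n L)) s _ He) as [d3 [Hd3 H3]].
destruct (proj2 (approx_continuity n (idx n L)) s _ He) as [d4 [Hd4 H4]].
exists (Rmin (Rmin d1 d2) (Rmin d3 d4)); split.
{ repeat apply Rmin_pos; assumption. }
intros t [Ht1 Ht2].
assert (Rmin (Rmin d1 d2) (Rmin d3 d4) <= d1 /\ Rmin (Rmin d1 d2) (Rmin d3 d4) <= d2 /\
  Rmin (Rmin d1 d2) (Rmin d3 d4) <= d3 /\ Rmin (Rmin d1 d2) (Rmin d3 d4) <= d4).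
{ unfold Rmin; repeat destruct (Rle_dec _ _); lra. }
simpl in *; unfold Rdist in *.
specialize (H1 t ltac:(split; [exact Ht1|lra])); specialize (H2 t ltac:(split; [exact Ht1|lra])).
specialize (H3 t ltac:(split; [exact Ht1|lra])); specialize (H4 t ltac:(split; [exact Ht1|lra])).
apply Rlt_div_r in H1; [|lra]; apply Rlt_div_r in H2; [|lra].
apply Rlt_div_r in H3; [|lra]; apply Rlt_div_r in H4; [|lra].
eapply Rle_lt_trans; [apply HPsi|].
repeat match goal with |- context [Rabs ?x] =>
  let y := fresh "y" in pose proof (Rabs_pos x); set (y := Rabs x) in * end.
nra.
Qed.

Lemma psin_ulim (lo hi : R) (sn : nat -> R) : (forall n, lo <= sn n <= hi) ->
  exists s u p, lo <= s <= hi /\ ivp L alpha beta f s u p /\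
    ulim (fun n => psin n (sn n)) (Psi (u sg) (p sg) (u L) (p L)).
Proof.
intro Hsn.
destruct (ivp_compact lo hi sn Hsn) as [s [u [p [Hs [Hivp Hlim]]]]].
exists s, u, p; split; [exact Hs|split; [exact Hivp|]].
intros eps Heps.
assert (Hlam : 0 <= lam).
{ pose proof (HPsi 1 0 0 0 0 0 0 0) as H.
  pose proof (Rabs_pos (Psi 1 0 0 0 - Psi 0 0 0 0)).
  rewrite !Rminus_0_r, Rabs_R1, Rabs_R0 in H; lra. }
assert (He : 0 < eps / (4 * (lam + 1))) by (apply Rdiv_lt_0_compat; lra).
assert (HLL : in0L L L) by (unfold in0L; lra).
apply Wmono with (2 := Wand _ _ (Wand _ _ (proj1 (Hlim _ Hsg) _ He) (proj2 (Hlim _ Hsg) _ He))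
  (Wand _ _ (proj1 (Hlim _ HLL) _ He) (proj2 (Hlim _ HLL) _ He))).
intros n [[H1 H2] [H3 H4]].
apply Rlt_div_r in H1; [|lra]; apply Rlt_div_r in H2; [|lra].
apply Rlt_div_r in H3; [|lra]; apply Rlt_div_r in H4; [|lra].
eapply Rle_lt_trans; [apply HPsi|].
repeat match goal with |- context [Rabs ?x] =>
  let y := fresh "y" in pose proof (Rabs_pos x); set (y := Rabs x) in * end.
nra.
Qed.

(** The signs at [s1] and [s2] pass to [W]-almost all polygons, since otherwise a limit with
    constant parameter would be a solution of the wrong sign; this is why the hypotheses speak of
    every solution. The classical theorem then gives a zero for each such polygon, and the limit
    keeps it. *)
Lemma shooting_ultra (s1 s2 : R) : s1 <= s2 ->
  (forall u p, ivp L alpha beta f s1 u p -> 0 < Psi (u sg) (p sg) (u L) (p L)) ->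
  (forall u p, ivp L alpha beta f s2 u p -> Psi (u sg) (p sg) (u L) (p L) < 0) ->
  exists s u p, s1 <= s <= s2 /\ ivp L alpha beta f s u p /\
    Psi (u sg) (p sg) (u L) (p L) = 0.
Proof.
intros H12 H1 H2.
assert (W1 : W (fun n => 0 < psin n s1)).
{ apply NNPP; intro Hn; apply Wneg in Hn.
  destruct (psin_ulim s1 s1 (fun _ => s1)) as [s [u [p [Hs [Hivp Hlim]]]]]; [intros; lra|].
  replace s with s1 in Hivp by lra.
  pose proof (H1 u p Hivp).
  assert (Psi (u sg) (p sg) (u L) (p L) <= 0); [|lra].
  apply (ulim_le _ _ _ Hlim), Wmono with (2 := Hn); intros n; lra. }
assert (W2 : W (fun n => psin n s2 < 0)).
{ apply NNPP; intro Hn; apply Wneg in Hn.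
  destruct (psin_ulim s2 s2 (fun _ => s2)) as [s [u [p [Hs [Hivp Hlim]]]]]; [intros; lra|].
  replace s with s2 in Hivp by lra.
  pose proof (H2 u p Hivp).
  assert (0 <= Psi (u sg) (p sg) (u L) (p L)); [|lra].
  apply (ulim_ge _ _ _ Hlim), Wmono with (2 := Hn); intros n; lra. }
(* For indices without the right signs the default is [s1], so that the whole sequence stays in the
   interval. *)
assert (Hc : forall n, exists s, s1 <= s <= s2 /\ (0 < psin n s1 -> psin n s2 < 0 -> psin n s = 0)).
{ intro n; destruct (classic (0 < psin n s1 /\ psin n s2 < 0)) as [[Ha Hb]|Hn].
  - destruct (IVT_gen (psin n) s1 s2 0 (psin_continuity n)) as [s [Hs1 Hs2]].
    { unfold Rmin, Rmax; repeat destruct (Rle_dec _ _); lra. }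
    rewrite Rmin_left, Rmax_right in Hs1 by lra.
    exists s; tauto.
  - exists s1; split; [lra|tauto]. }
set (sn := fun n => proj1_sig (constructive_indefinite_description _ (Hc n))).
assert (Hsn : forall n, s1 <= sn n <= s2 /\ (0 < psin n s1 -> psin n s2 < 0 -> psin n (sn n) = 0)).
{ intro n; exact (proj2_sig (constructive_indefinite_description _ (Hc n))). }
destruct (psin_ulim s1 s2 sn) as [s [u [p [Hs [Hivp Hlim]]]]]; [intro n; apply Hsn|].
exists s, u, p; split; [exact Hs|split; [exact Hivp|]].
apply Rle_antisym; [apply (ulim_le _ _ _ Hlim)|apply (ulim_ge _ _ _ Hlim)];
  apply Wmono with (2 := Wand _ _ W1 W2); intros n [Ha Hb];
  pose proof (proj2 (Hsn n) Ha Hb); lra.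
Qed.

End Ultralimit.

(* Continuous dependence fails for the initial value problem itself, as [f] is
   merely continuous; it holds for the Euler polygons, and an ultrafilter limit
   of the Euler polygons through the intermediate values solves the problem. *)
Lemma shooting_ivt (L alpha beta Bf : R) (f : R -> R -> R) (sg lam : R)
  (Psi : R -> R -> R -> R -> R) (s1 s2 : R) : 0 < L ->
  (forall x u, Rabs (f x u) <= Bf) ->
  (forall x u eps, 0 < eps -> exists del, 0 < del /\
     forall x' u', Rabs (x' - x) < del -> Rabs (u' - u) < del ->
       Rabs (f x' u' - f x u) < eps) ->
  in0L L sg ->
  (forall a b c d a' b' c' d', Rabs (Psi a b c d - Psi a' b' c' d') <=
     lam * (Rabs (a - a') + Rabs (b - b') + Rabs (c - c') + Rabs (d - d'))) ->
  s1 <= s2 ->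
  (forall u p, ivp L alpha beta f s1 u p -> 0 < Psi (u sg) (p sg) (u L) (p L)) ->
  (forall u p, ivp L alpha beta f s2 u p -> Psi (u sg) (p sg) (u L) (p L) < 0) ->
  exists s u p, s1 <= s <= s2 /\ ivp L alpha beta f s u p /\
    Psi (u sg) (p sg) (u L) (p L) = 0.
Proof.
intros HL Hfb Hfc Hsg HPsi H12 H1 H2.
destruct ultrafilter_nat as [W [Wmono [Wand [Wex [Wneg Wlarge]]]]].
apply (shooting_ultra W Wmono Wand Wex Wneg Wlarge L HL alpha beta Bf f Hfb Hfc sg Hsg
  lam Psi HPsi s1 s2 H12 H1 H2).
Qed.

(** * Qualitative behaviour of solutions *)

(** [z] is the supremum of the abscissas up to which [f] stays below [v]. *)
Lemma first_crossing (L : R) (f : R -> R) (x y v : R) : cont_on (in0L L) f ->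
  0 <= x -> x <= y -> y <= L -> f x < v -> v <= f y ->
  exists z, x < z <= y /\ f z = v /\ forall t, x <= t < z -> f t < v.
Proof.
intros Hf Hx Hxy Hy Hfx Hfy.
set (E := fun t => x <= t <= y /\ forall t', x <= t' <= t -> f t' < v).
destruct (completeness E) as [z [Hub Hlub]].
{ exists y; intros t [Ht _]; lra. }
{ exists x; split; [lra|]; intros t Ht; replace t with x by lra; exact Hfx. }
assert (Hxz : x <= z).
{ apply Hub; split; [lra|]; intros t Ht; replace t with x by lra; exact Hfx. }
assert (Hzy : z <= y) by (apply Hlub; intros t [Ht _]; lra).
assert (Hbelow : forall t, x <= t < z -> f t < v).
{ intros t Ht; apply NNPP; intro Hn.
  assert (z <= t); [|lra].
  apply Hlub; intros r [Hr1 Hr2]; apply Rnot_lt_le; intro Hlt.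
  apply Hn, Hr2; lra. }
assert (HzL : in0L L z) by (unfold in0L; lra).
assert (Hfz : f z = v).
{ destruct (Rtotal_order (f z) v) as [Hlt|[Heq|Hgt]]; [exfalso|exact Heq|exfalso].
  - destruct (Hf z HzL (v - f z) ltac:(lra)) as [d [Hd H]].
    assert (Hz' : z < y).
    { destruct (Req_dec z y) as [->|]; [lra|lra]. }
    assert (z + Rmin (d / 2) (y - z) <= z); [|assert (0 < Rmin (d / 2) (y - z))
      by (apply Rmin_pos; lra); lra].
    pose proof (Rmin_l (d / 2) (y - z)); pose proof (Rmin_r (d / 2) (y - z)).
    assert (0 < Rmin (d / 2) (y - z)) by (apply Rmin_pos; lra).
    apply Hub; split; [lra|]; intros t Ht.
    destruct (Rlt_le_dec t z) as [Htz|Htz]; [apply Hbelow; lra|].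
    assert (Hft : Rabs (f t - f z) < v - f z).
    { apply H; [unfold in0L; lra|]; rewrite Rabs_pos_eq; lra. }
    apply Rabs_lt_between in Hft; lra.
  - assert (Hz' : x < z).
    { destruct (Req_dec x z) as [->|]; [lra|lra]. }
    destruct (Hf z HzL (f z - v) ltac:(lra)) as [d [Hd H]].
    set (m := Rmin (d / 2) (z - x)).
    assert (Hm : 0 < m) by (apply Rmin_pos; lra).
    assert (m <= d / 2) by apply Rmin_l; assert (m <= z - x) by apply Rmin_r.
    assert (Hft : Rabs (f (z - m) - f z) < f z - v).
    { apply H; [unfold in0L; lra|]; rewrite Rabs_left; lra. }
    apply Rabs_lt_between in Hft.
    specialize (Hbelow (z - m) ltac:(lra)); lra. }
exists z; split; [|split; [exact Hfz|exact Hbelow]].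
split; [|exact Hzy].
destruct (Req_dec x z) as [Hxz'|]; [subst; lra|lra].
Qed.

Definition field (a b G H : R -> R) (mu x u : R) : R := - (a x * G u) + mu * b x * H u.

(** Substitute for a Lipschitz condition: linear growth at 0, on every bounded range. It is enough
    for comparison with the zero solution. *)
Definition linear_near_0 (G : R -> R) : Prop :=
  forall V, exists C, 0 <= C /\ forall s, Rabs s <= V -> Rabs (G s) <= C * Rabs s.

Section Field.

Context (L alpha beta : R) (HL : 0 < L) (Hbe : 0 <= beta)
  (Hab : 0 < alpha + beta).
Context (a b G H : R -> R) (mu A B : R) (Hmu : 0 <= mu).
Context (Ha : forall x, in0L L x -> 0 <= a x <= A) (Hb : forall x, in0L L x -> 0 <= b x <= B).
Context (G_ge0 : forall s, 0 <= G s) (G_neg : forall s, s <= 0 -> G s = 0)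
  (G_lin : linear_near_0 G).
Context (H_ge0 : forall s, 0 <= H s) (H_neg : forall s, s <= 0 -> H s = 0)
  (H_lin : linear_near_0 H).

Let sol := ivp L alpha beta (field a b G H mu).

Lemma field_lin (V : R) : exists K, 0 <= K /\ forall t v, in0L L t -> Rabs v <= V ->
  Rabs (field a b G H mu t v) <= K * Rabs v.
Proof.
destruct (G_lin V) as [C1 [HC1 HG]]; destruct (H_lin V) as [C2 [HC2 HH]].
assert (H0L : in0L L 0) by (unfold in0L; lra).
pose proof (Ha 0 H0L); pose proof (Hb 0 H0L).
exists (A * C1 + mu * B * C2); split.
{ assert (0 <= A * C1) by (apply Rmult_le_pos; lra).
  assert (0 <= mu * B * C2) by (repeat apply Rmult_le_pos; lra); lra. }
intros t v Ht Hv; unfold field.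
eapply Rle_trans; [apply Rabs_triang|].
rewrite Rabs_Ropp, !Rabs_mult.
destruct (Ha t Ht) as [Ha1 Ha2]; destruct (Hb t Ht) as [Hb1 Hb2].
specialize (HG _ Hv); specialize (HH _ Hv).
rewrite (Rabs_pos_eq mu), (Rabs_pos_eq (a t)), (Rabs_pos_eq (b t)) by assumption.
replace ((A * C1 + mu * B * C2) * Rabs v) with
  (A * (C1 * Rabs v) + (mu * B) * (C2 * Rabs v)) by ring.
apply Rplus_le_compat; apply Rmult_le_compat; try assumption; try apply Rabs_pos.
- apply Rmult_le_pos; assumption.
- apply Rmult_le_compat_l; assumption.
Qed.

(* Gronwall for [u^2 + p^2]: the field is Lipschitz at 0 although not elsewhere. *)
Lemma sol_zero (s : R) (u p : R -> R) (x0 : R) : sol s u p -> in0L L x0 ->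
  u x0 = 0 -> p x0 = 0 -> forall x, in0L L x -> u x = 0 /\ p x = 0.
Proof.
intros [Hu [Hp _]] Hx0 Hu0 Hp0 x Hx.
pose proof (has_deriv_in_cont L u p Hu) as Cu.
pose proof (has_deriv_in_cont L p _ Hp) as Cp.
destruct (cont_on_bounded L u (Rlt_le _ _ HL) Cu) as [V [HV HuV]].
destruct (field_lin V) as [K [HK0 HKl]].
assert (HK : forall t, in0L L t -> Rabs (field a b G H mu t (u t)) <= K * Rabs (u t))
  by (intros t Ht; apply HKl; [exact Ht|apply HuV, Ht]).
(* Weighted energy: with [c = 1 + K] it is nondecreasing, which serves to the left of [x0]; with
   [c = - (1 + K)] it is nonincreasing, which serves to the right. *)
set (phi := fun c t => (u t * u t + p t * p t) * exp (c * t)).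
set (dphi := fun c t => (2 * u t * p t + 2 * p t * field a b G H mu t (u t)
   + c * (u t * u t + p t * p t)) * exp (c * t)).
assert (Hphi : forall c t, 0 < t < L -> is_derive (phi c) t (dphi c t)).
{ intros c t Ht.
  assert (HtL : in0L L t) by (unfold in0L; lra).
  pose proof (has_deriv_in_is_derive L u t _ Ht (Hu t HtL)) as D1.
  pose proof (has_deriv_in_is_derive L p t _ Ht (Hp t HtL)) as D2.
  unfold phi, dphi.
  auto_derive.
  - repeat split; try exact I; eexists; eassumption.
  - change (Derive (fun x => u x) t) with (Derive u t).
    change (Derive (fun x => p x) t) with (Derive p t).
    rewrite (is_derive_unique _ _ _ D1), (is_derive_unique _ _ _ D2); ring. }
assert (Hcont : forall c, continuity (fun t => phi c (clamp L t))).
{ intro c; unfold phi.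
  pose proof (clamp_continuity L u (Rlt_le _ _ HL) Cu) as Ku.
  pose proof (clamp_continuity L p (Rlt_le _ _ HL) Cp) as Kp.
  apply continuity_mult.
  - apply continuity_plus; apply continuity_mult; assumption.
  - apply (continuity_comp (fun t => c * clamp L t) exp).
    + apply continuity_scal; apply (clamp_continuity L (fun t => t)); [lra|].
      intros t _ eps Heps; exists eps; split; [exact Heps|]; intros; assumption.
    + apply derivable_continuous, derivable_exp. }
assert (Hd : forall t, in0L L t ->
  Rabs (2 * u t * p t + 2 * p t * field a b G H mu t (u t)) <= (1 + K) * (u t * u t + p t * p t)).
{ intros t Ht; specialize (HK t Ht).
  replace (2 * u t * p t + 2 * p t * field a b G H mu t (u t)) with
    (2 * (u t * p t + p t * field a b G H mu t (u t))) by ring.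
  rewrite Rabs_mult, (Rabs_pos_eq 2) by lra.
  assert (H0 : Rabs (u t * p t + p t * field a b G H mu t (u t))
    <= (1 + K) * (Rabs (u t) * Rabs (p t))).
  { eapply Rle_trans; [apply Rabs_triang|]; rewrite !Rabs_mult.
    pose proof (Rabs_pos (p t)); pose proof (Rabs_pos (u t)); nra. }
  assert (H1 : 2 * (Rabs (u t) * Rabs (p t)) <= u t * u t + p t * p t).
  { rewrite <- (Rabs_pos_eq (u t * u t)), <- (Rabs_pos_eq (p t * p t)) by nra.
    rewrite !Rabs_mult; pose proof (Rle_0_sqr (Rabs (u t) - Rabs (p t))) as Hs.
    unfold Rsqr in Hs; lra. }
  nra. }
assert (Hzero : u x * u x + p x * p x <= 0).
{ destruct (Rtotal_order x x0) as [Hlt|[->|Hgt]].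
  - destruct (mvt_open L (phi (1 + K)) (dphi (1 + K)) x x0 (Hcont _) (Hphi _)
      (proj1 Hx) Hlt (proj2 Hx0)) as [c [Hc Heq]].
    assert (HcL : in0L L c) by (unfold in0L in *; lra).
    specialize (Hd c HcL); apply Rabs_le_between in Hd.
    assert (0 <= dphi (1 + K) c * (x0 - x)).
    { apply Rmult_le_pos; [|lra]; apply Rmult_le_pos; [lra|apply Rlt_le, exp_pos]. }
    unfold phi in Heq; rewrite Hu0, Hp0 in Heq.
    pose proof (exp_pos ((1 + K) * x)).
    apply Rnot_lt_le; intro Hpos; nra.
  - rewrite Hu0, Hp0; lra.
  - destruct (mvt_open L (phi (- (1 + K))) (dphi (- (1 + K))) x0 x (Hcont _) (Hphi _)
      (proj1 Hx0) Hgt (proj2 Hx)) as [c [Hc Heq]].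
    assert (HcL : in0L L c) by (unfold in0L in *; lra).
    specialize (Hd c HcL); apply Rabs_le_between in Hd.
    assert (dphi (- (1 + K)) c * (x - x0) <= 0).
    { unfold dphi; pose proof (exp_pos (- (1 + K) * c)).
      assert (0 <= (x - x0) * exp (- (1 + K) * c)) by (apply Rmult_le_pos; lra).
      nra. }
    unfold phi in Heq; rewrite Hu0, Hp0 in Heq.
    pose proof (exp_pos (- (1 + K) * x)).
    apply Rnot_lt_le; intro Hpos; nra. }
split; nra.
Qed.

(** Where [u <= 0] the field vanishes and [p] is constant. If [p] ever rose to [p x0 / 2], then up
    to the first such point [u] would have stayed nonpositive, so [p] would not have changed at
    all. *)
Lemma sol_neg (s : R) (u p : R -> R) (x0 : R) : sol s u p -> in0L L x0 ->
  u x0 <= 0 -> p x0 < 0 ->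
  forall x, x0 <= x <= L -> p x < 0 /\ u x <= 0 /\ (x0 < x -> u x < 0).
Proof.
intros [Hu [Hp _]] Hx0 Hux0 Hpx0.
pose proof (has_deriv_in_cont L p _ Hp) as Cp.
assert (Hlow : forall x, x0 <= x <= L -> p x < p x0 / 2).
{ intros x Hx; apply Rnot_le_lt; intro Hn.
  destruct (first_crossing L p x0 x (p x0 / 2) Cp (proj1 Hx0) (proj1 Hx) (proj2 Hx)
    ltac:(lra) Hn) as [z [Hz [Hpz Hbelow]]].
  assert (Hle : forall t, x0 <= t <= z -> u t <= 0).
  { intros t Ht.
    assert (u t <= u x0 + 0 * (t - x0)); [|lra].
    apply (deriv_le L u p); try (unfold in0L in *; lra); [exact Hu|].
    intros c Hc; destruct (Rlt_le_dec c z) as [Hcz|Hcz].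
    - specialize (Hbelow c ltac:(lra)); lra.
    - replace c with z by lra; lra. }
  destruct (mvt_in L p _ x0 z Hp (proj1 Hx0) ltac:(lra) ltac:(lra)) as [c [Hc Heq]].
  unfold field in Heq; rewrite G_neg, H_neg in Heq by (apply Hle; exact Hc).
  lra. }
intros x Hx; pose proof (Hlow x Hx).
assert (u x <= u x0 + p x0 / 2 * (x - x0)).
{ apply (deriv_le L u p); try (unfold in0L in *; lra); [exact Hu|].
  intros c Hc; apply Rlt_le, Hlow; lra. }
split; [lra|split; [nra|intro; nra]].
Qed.

(** For [s > 0] the solution is positive somewhere before [x0]. At its first zero after that the
    slope is not positive, and it is not 0 either, since otherwise [u] and [p] would vanish
    identically and force [s = 0]; from there on [sol_neg] applies. *)
Lemma sol_nonpos (s : R) (u p : R -> R) (x0 : R) : sol s u p -> 0 < s ->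
  0 < x0 <= L -> u x0 <= 0 -> p x0 < 0.
Proof.
intros Hsol Hs Hx0 Hux0.
pose proof Hsol as [Hu [Hp [Hu0 Hp0]]].
assert (H0L : in0L L 0) by (unfold in0L; lra).
assert (Hy : exists y, 0 <= y < x0 /\ 0 < u y).
{ destruct (Rle_lt_or_eq_dec 0 (u 0)) as [Hpos|Heq].
  - rewrite Hu0; apply Rmult_le_pos; lra.
  - exists 0; split; [lra|exact Hpos].
  - assert (Hb0 : beta = 0) by nra.
    assert (Hp0' : 0 < p 0) by (rewrite Hp0; apply Rmult_lt_0_compat; lra).
    destruct (has_deriv_in_le L u 0 (p 0) (p 0 / 2) H0L (Hu 0 H0L) ltac:(lra))
      as [d [Hd Hder]].
    set (m := Rmin (d / 2) (x0 / 2)).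
    assert (Hm : 0 < m) by (apply Rmin_pos; lra).
    assert (m <= d / 2) by apply Rmin_l; assert (m <= x0 / 2) by apply Rmin_r.
    exists m; split; [lra|].
    specialize (Hder m ltac:(lra)).
    rewrite Rminus_0_r, (Rabs_pos_eq m) in Hder by lra.
    specialize (Hder ltac:(lra)); apply Rabs_le_between in Hder; nra. }
destruct Hy as [y [Hy Huy]].
pose proof (has_deriv_in_cont L u p Hu) as Cu.
assert (Cn : cont_on (in0L L) (fun x => - u x)).
{ intros x Hx eps Heps; destruct (Cu x Hx eps Heps) as [d [Hd Hc]].
  exists d; split; [exact Hd|]; intros t Ht Htx.
  replace (- u t - - u x) with (- (u t - u x)) by ring.
  rewrite Rabs_Ropp; apply Hc; assumption. }
destruct (first_crossing L _ y x0 0 Cn ltac:(lra) ltac:(lra) ltac:(lra) ltac:(lra) ltac:(lra))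
  as [z [Hz [Huz Hpos]]].
assert (HzL : in0L L z) by (unfold in0L; lra).
assert (Huz0 : u z = 0) by lra.
destruct (Rtotal_order (p z) 0) as [Hneg|[Heq|Hgt]].
- apply (sol_neg s u p z Hsol HzL ltac:(lra) Hneg); lra.
- exfalso.
  destruct (sol_zero s u p z Hsol HzL Huz0 Heq 0 H0L) as [E1 E2].
  rewrite E1 in Hu0; rewrite E2 in Hp0; nra.
- exfalso.
  destruct (has_deriv_in_le L u z (p z) (p z / 2) HzL (Hu z HzL) ltac:(lra))
    as [d [Hd Hder]].
  set (m := Rmin (d / 2) ((z - y) / 2)).
  assert (Hm : 0 < m) by (apply Rmin_pos; lra).
  assert (m <= d / 2) by apply Rmin_l; assert (m <= (z - y) / 2) by apply Rmin_r.
  specialize (Hder (z - m) ltac:(lra)); specialize (Hpos (z - m) ltac:(lra)).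
  replace (z - m - z) with (- m) in Hder by ring.
  rewrite Rabs_Ropp, (Rabs_pos_eq m) in Hder by lra.
  specialize (Hder ltac:(lra)); apply Rabs_le_between in Hder; nra.
Qed.

Lemma sol_nonpos_after (s : R) (u p : R -> R) (x0 x : R) : sol s u p -> 0 < s ->
  0 < x0 -> x0 <= x <= L -> u x0 <= 0 -> p x < 0 /\ u x <= 0 /\ (x0 < x -> u x < 0).
Proof.
intros Hsol Hs Hx0 Hx Hu0.
apply (sol_neg s u p x0 Hsol); [unfold in0L; lra|exact Hu0| |exact Hx].
apply (sol_nonpos s u p x0 Hsol Hs); [lra|exact Hu0].
Qed.

(** A nonpositive interior value would lead to [u L < 0] and [p L < 0]. The weak inequality, rather
    than equality, lets the lemma also serve to prove the boundary form negative by
    contradiction. *)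
Lemma sol_pos (gamma delta s : R) (u p : R -> R) : sol s u p -> 0 < s ->
  0 <= gamma -> 0 <= delta -> 0 < gamma + delta ->
  0 <= gamma * u L + delta * p L -> forall x, 0 < x < L -> 0 < u x.
Proof.
intros Hsol Hs Hg Hd Hgd HF x Hx; apply Rnot_le_lt; intro Hn.
destruct (sol_nonpos_after s u p x L Hsol Hs ltac:(lra) ltac:(lra) Hn) as [H1 [_ H2]].
specialize (H2 ltac:(lra)).
destruct (Req_dec gamma 0) as [Hz|Hz]; nra.
Qed.

Lemma sol_ge0 (s : R) (u p : R -> R) (c d : R) : sol s u p -> 0 <= c -> c < d -> d <= L ->
  (forall x, c < x < d -> 0 < u x) -> forall x, c <= x <= d -> 0 <= u x.
Proof.
intros [Hu _] Hc Hcd Hd Hpos x Hx; apply Rnot_lt_le; intro Hn.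
destruct (has_deriv_in_cont L u p Hu x ltac:(unfold in0L; lra) (- u x) ltac:(lra))
  as [e [He Hlim]].
set (m := Rmin (e / 2) ((d - c) / 2)).
assert (Hm : 0 < m) by (apply Rmin_pos; lra).
assert (m <= e / 2) by apply Rmin_l; assert (m <= (d - c) / 2) by apply Rmin_r.
assert (Hy : exists y, c < y < d /\ Rabs (y - x) < e).
{ destruct (Rle_lt_dec x ((c + d) / 2)).
  - exists (x + m / 2); split; [lra|]; replace (x + m / 2 - x) with (m / 2) by ring.
    rewrite Rabs_pos_eq; lra.
  - exists (x - m / 2); split; [lra|]; replace (x - m / 2 - x) with (- (m / 2)) by ring.
    rewrite Rabs_Ropp, Rabs_pos_eq; lra. }
destruct Hy as [y [Hy Hyx]].
specialize (Hlim y ltac:(unfold in0L; lra) Hyx); apply Rabs_lt_between in Hlim.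
specialize (Hpos y Hy); lra.
Qed.

(** * Concavity, convexity and quantitative growth *)

Lemma field_concave (x u : R) : in0L L x -> b x = 0 -> field a b G H mu x u <= 0.
Proof.
intros Hx Hbx; unfold field; rewrite Hbx.
pose proof (Ha x Hx); pose proof (G_ge0 u).
assert (0 <= a x * G u) by (apply Rmult_le_pos; lra); lra.
Qed.

Lemma field_convex (x u : R) : in0L L x -> a x = 0 -> 0 <= field a b G H mu x u.
Proof.
intros Hx Hax; unfold field; rewrite Hax.
pose proof (Hb x Hx); pose proof (H_ge0 u).
assert (0 <= mu * b x * H u) by (repeat apply Rmult_le_pos; lra); lra.
Qed.

Lemma sol_concave (s : R) (u p : R -> R) (c d : R) : sol s u p -> 0 <= c -> d <= L ->
  (forall x, c <= x <= d -> b x = 0) ->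
  forall x y, c <= x -> x <= y -> y <= d ->
    p y <= p x /\ p y * (y - x) <= u y - u x <= p x * (y - x).
Proof.
intros [Hu [Hp _]] Hc Hd Hb0.
assert (Hmono : forall x y, c <= x -> x <= y -> y <= d -> p y <= p x).
{ intros x y Hx Hxy Hy.
  assert (p y <= p x + 0 * (y - x)); [|lra].
  apply (deriv_le L p (fun t => field a b G H mu t (u t))); try lra; [exact Hp|].
  intros t Ht; apply field_concave; [unfold in0L; lra|apply Hb0; lra]. }
intros x y Hx Hxy Hy; split; [apply Hmono; assumption|].
destruct (mvt_in L u p x y Hu ltac:(lra) Hxy ltac:(lra)) as [t [Ht Heq]].
rewrite Heq; pose proof (Hmono x t ltac:(lra) ltac:(lra) ltac:(lra)).
pose proof (Hmono t y ltac:(lra) ltac:(lra) ltac:(lra)); nra.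
Qed.

Lemma sol_convex (s : R) (u p : R -> R) (c d : R) : sol s u p -> 0 <= c -> d <= L ->
  (forall x, c <= x <= d -> a x = 0) ->
  forall x y, c <= x -> x <= y -> y <= d ->
    p x <= p y /\ p x * (y - x) <= u y - u x <= p y * (y - x).
Proof.
intros [Hu [Hp _]] Hc Hd Ha0.
assert (Hmono : forall x y, c <= x -> x <= y -> y <= d -> p x <= p y).
{ intros x y Hx Hxy Hy.
  assert (p x + 0 * (y - x) <= p y); [|lra].
  apply (deriv_ge L p (fun t => field a b G H mu t (u t))); try lra; [exact Hp|].
  intros t Ht; apply field_convex; [unfold in0L; lra|apply Ha0; lra]. }
intros x y Hx Hxy Hy; split; [apply Hmono; assumption|].
destruct (mvt_in L u p x y Hu ltac:(lra) Hxy ltac:(lra)) as [t [Ht Heq]].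
rewrite Heq; pose proof (Hmono x t ltac:(lra) ltac:(lra) ltac:(lra)).
pose proof (Hmono t y ltac:(lra) ltac:(lra) ltac:(lra)); nra.
Qed.

(* If the maximum [m] over [[c, d]] exceeded [4 R0], then [u >= m/4 > R0] on the
   middle half, where [p] would have to drop by more than the [8 m / (d - c)]
   that concavity and nonnegativity leave available. *)
Lemma sol_large (s : R) (u p : R -> R) (c d a0 M R0 : R) : sol s u p ->
  0 <= c -> c < d -> d <= L -> 0 < a0 -> 0 <= R0 ->
  (forall x, c <= x <= d -> b x = 0) ->
  (forall x, c + (d - c) / 4 <= x <= d - (d - c) / 4 -> a0 <= a x) ->
  (forall t, R0 < t -> M * t <= G t) -> 64 < a0 * M * (d - c) ^ 2 ->
  (forall x, c <= x <= d -> 0 <= u x) -> forall x, c <= x <= d -> u x <= 4 * R0.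
Proof.
intros Hsol Hc Hcd Hd Ha0 HR0 Hb0 Haa HM HMl Hu0 x Hx.
pose proof (sol_concave s u p c d Hsol Hc Hd Hb0) as Hcv.
pose proof Hsol as [Hu [Hp _]].
pose proof (clamp_continuity L u (Rlt_le _ _ HL) (has_deriv_in_cont L u p Hu)) as Cu.
destruct (continuity_ab_maj _ c d (Rlt_le _ _ Hcd) (fun t _ => Cu t)) as [x0 [Hmax Hx0]].
assert (Hmax' : forall t, c <= t <= d -> u t <= u x0).
{ intros t Ht; specialize (Hmax t Ht); rewrite !clamp_id in Hmax by lra; exact Hmax. }
clear Hmax.
apply Rnot_lt_le; intro Hlt.
pose proof (Hmax' x Hx) as Hm.
set (m := u x0) in *; set (l := d - c) in *.
assert (Hl : 0 < l) by (unfold l; lra).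
assert (Hquarter : forall t, c + l / 4 <= t <= d - l / 4 -> m / 4 <= u t).
{ intros t Ht; unfold l in Ht.
  destruct (Rle_lt_dec t x0) as [Htx|Htx].
  - destruct (Hcv c t ltac:(lra) ltac:(lra) ltac:(lra)) as [_ [H1 _]].
    destruct (Hcv t x0 ltac:(lra) ltac:(lra) ltac:(lra)) as [_ [_ H2]].
    pose proof (Hu0 c ltac:(lra)); fold m in H2.
    assert (m * (t - c) <= u t * (x0 - c)) by nra.
    assert (x0 - c <= l) by (unfold l; lra).
    assert (l / 4 <= t - c) by (unfold l; lra).
    pose proof (Hu0 t ltac:(lra)).
    assert (m * (l / 4) <= u t * l) by nra.
    nra.
  - destruct (Hcv t d ltac:(lra) ltac:(lra) ltac:(lra)) as [_ [_ H1]].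
    destruct (Hcv x0 t ltac:(lra) ltac:(lra) ltac:(lra)) as [_ [H2 _]].
    pose proof (Hu0 d ltac:(lra)); fold m in H2.
    assert (m * (d - t) <= u t * (d - x0)) by nra.
    assert (d - x0 <= l) by (unfold l; lra).
    assert (l / 4 <= d - t) by (unfold l; lra).
    pose proof (Hu0 t ltac:(lra)).
    assert (m * (l / 4) <= u t * l) by nra.
    nra. }
assert (HM0 : 0 < M).
{ assert (0 < l ^ 2) by (apply pow_lt; exact Hl).
  apply Rnot_le_lt; intro HMn.
  assert (a0 * M * l ^ 2 <= 0); [|lra].
  assert (0 <= a0 * l ^ 2) by (apply Rmult_le_pos; lra); nra. }
assert (Hdrop : p (d - l / 4) <= p (c + l / 4) + - (a0 * M * (m / 4)) * (d - l / 4 - (c + l / 4))).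
{ apply (deriv_le L p (fun t => field a b G H mu t (u t))); try (unfold l; lra); [exact Hp|].
  intros t Ht; unfold field.
  assert (Ht' : c <= t <= d) by (unfold l in Ht; lra).
  rewrite (Hb0 t Ht').
  pose proof (Hquarter t Ht) as Hq; pose proof (Haa t Ht).
  assert (HG : M * (m / 4) <= G (u t)).
  { eapply Rle_trans; [|apply HM; lra]; apply Rmult_le_compat_l; lra. }
  assert (a0 * (M * (m / 4)) <= a t * G (u t)).
  { apply Rmult_le_compat; try lra; apply Rmult_le_pos; lra. }
  lra. }
destruct (Hcv c (c + l / 4) ltac:(lra) ltac:(lra) ltac:(unfold l; lra)) as [_ [H1 _]].
destruct (Hcv (d - l / 4) d ltac:(unfold l; lra) ltac:(lra) ltac:(lra)) as [_ [_ H2]].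
pose proof (Hu0 c ltac:(lra)); pose proof (Hu0 d ltac:(lra)).
pose proof (Hmax' (c + l / 4) ltac:(unfold l; lra)) as E3.
pose proof (Hmax' (d - l / 4) ltac:(unfold l; lra)) as E4.
fold m in E3, E4.
replace (c + l / 4 - c) with (l / 4) in H1 by ring.
replace (d - (d - l / 4)) with (l / 4) in H2 by ring.
replace (d - l / 4 - (c + l / 4)) with (l / 2) in Hdrop by (unfold l; lra).
(* The end quarters limit the slopes by [4 m / l], so [p] drops by at most [8 m / l], while it drops
   by at least [a0 * M * m * l / 8]; together [a0 * M * l ^ 2 <= 64]. *)
assert (Hmul : (l / 4) * (a0 * M * (m / 4) * (l / 2)) <= 2 * m) by nra.
assert (Hm0 : 0 < m) by lra.
assert (Hid : (l / 4) * (a0 * M * (m / 4) * (l / 2)) = m * (a0 * M * l ^ 2) / 32) by field.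
rewrite Hid in Hmul; nra.
Qed.

(** The tangent at [c] lies below the convex function [u] and is at least [q] at both ends, so
    [u >= q] and [H] is at least [kap] along the solution. The slope then gains
    [mu * b0 * kap * (d - c) / 2] over the middle half, and the last quarter turns this gain into
    height above the tangent. *)
Lemma sol_grow_right (s : R) (u p : R -> R) (c d b0 kap q : R) : sol s u p ->
  0 <= c -> c < d -> d <= L -> 0 <= b0 -> 0 <= kap ->
  (forall x, c <= x <= d -> a x = 0) ->
  (forall x, c + (d - c) / 4 <= x <= d - (d - c) / 4 -> b0 <= b x) ->
  (forall t, q <= t -> kap <= H t) ->
  q <= u c -> q <= u c + p c * (d - c) -> q + mu * b0 * kap * (d - c) ^ 2 / 8 <= u d.
Proof.
intros Hsol Hc Hcd Hd Hb0 Hkap Ha0 Hbb HH Hq1 Hq2.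
pose proof (sol_convex s u p c d Hsol Hc Hd Ha0) as Hcv.
pose proof Hsol as [Hu [Hp _]].
assert (Huq : forall x, c <= x <= d -> q <= u x).
{ intros x Hx; destruct (Hcv c x ltac:(lra) ltac:(lra) ltac:(lra)) as [_ [H1 _]].
  destruct (Rle_lt_dec 0 (p c)); nra. }
set (l := d - c) in *.
assert (Hl : 0 < l) by (unfold l; lra).
assert (Hrise : p (c + l / 4) + mu * b0 * kap * (d - l / 4 - (c + l / 4)) <= p (d - l / 4)).
{ apply (deriv_ge L p (fun t => field a b G H mu t (u t))); try (unfold l; lra); [exact Hp|].
  intros t Ht; unfold field.
  assert (Ht' : c <= t <= d) by (unfold l in Ht; lra).
  rewrite (Ha0 t Ht'); pose proof (Hbb t Ht); pose proof (HH _ (Huq t Ht')).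
  assert (mu * b0 * kap <= mu * b t * H (u t)); [|lra].
  apply Rmult_le_compat; try lra; [apply Rmult_le_pos; lra|].
  apply Rmult_le_compat_l; lra. }
replace (d - l / 4 - (c + l / 4)) with (l / 2) in Hrise by (unfold l; lra).
destruct (Hcv c (c + l / 4) ltac:(lra) ltac:(lra) ltac:(unfold l; lra)) as [H1 _].
destruct (Hcv c (d - l / 4) ltac:(lra) ltac:(unfold l; lra) ltac:(lra)) as [_ [H2 _]].
destruct (Hcv (d - l / 4) d ltac:(unfold l; lra) ltac:(lra) ltac:(lra)) as [_ [H3 _]].
replace (d - (d - l / 4)) with (l / 4) in H3 by ring.
replace (d - l / 4 - c) with (3 * l / 4) in H2 by (unfold l; lra).
simpl; nra.
Qed.

(** Mirror image, with the tangent at [d] and the gain read off on the first quarter. *)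
Lemma sol_grow_left (s : R) (u p : R -> R) (c d b0 kap q : R) : sol s u p ->
  0 <= c -> c < d -> d <= L -> 0 <= b0 -> 0 <= kap ->
  (forall x, c <= x <= d -> a x = 0) ->
  (forall x, c + (d - c) / 4 <= x <= d - (d - c) / 4 -> b0 <= b x) ->
  (forall t, q <= t -> kap <= H t) ->
  q <= u d -> q <= u d - p d * (d - c) -> q + mu * b0 * kap * (d - c) ^ 2 / 8 <= u c.
Proof.
intros Hsol Hc Hcd Hd Hb0 Hkap Ha0 Hbb HH Hq1 Hq2.
pose proof (sol_convex s u p c d Hsol Hc Hd Ha0) as Hcv.
pose proof Hsol as [Hu [Hp _]].
assert (Huq : forall x, c <= x <= d -> q <= u x).
{ intros x Hx; destruct (Hcv x d ltac:(lra) ltac:(lra) ltac:(lra)) as [_ [_ H1]].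
  destruct (Rle_lt_dec 0 (p d)); nra. }
set (l := d - c) in *.
assert (Hl : 0 < l) by (unfold l; lra).
assert (Hrise : p (c + l / 4) + mu * b0 * kap * (d - l / 4 - (c + l / 4)) <= p (d - l / 4)).
{ apply (deriv_ge L p (fun t => field a b G H mu t (u t))); try (unfold l; lra); [exact Hp|].
  intros t Ht; unfold field.
  assert (Ht' : c <= t <= d) by (unfold l in Ht; lra).
  rewrite (Ha0 t Ht'); pose proof (Hbb t Ht); pose proof (HH _ (Huq t Ht')).
  assert (mu * b0 * kap <= mu * b t * H (u t)); [|lra].
  apply Rmult_le_compat; try lra; [apply Rmult_le_pos; lra|].
  apply Rmult_le_compat_l; lra. }
replace (d - l / 4 - (c + l / 4)) with (l / 2) in Hrise by (unfold l; lra).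
destruct (Hcv (d - l / 4) d ltac:(unfold l; lra) ltac:(lra) ltac:(lra)) as [H1 _].
destruct (Hcv (c + l / 4) d ltac:(lra) ltac:(unfold l; lra) ltac:(lra)) as [_ [_ H2]].
destruct (Hcv c (c + l / 4) ltac:(lra) ltac:(lra) ltac:(unfold l; lra)) as [_ [_ H3]].
replace (c + l / 4 - c) with (l / 4) in H3 by ring.
replace (d - (c + l / 4)) with (3 * l / 4) in H2 by (unfold l; lra).
simpl; nra.
Qed.

End Field.

(** * Shooting *)

Lemma fsum_scal_le (n : nat) (f h : nat -> R) (c : R) :
  (forall i, (i < n)%nat -> f i <= c * h i) -> fsum n f <= c * fsum n h.
Proof.
induction n as [|n IH]; intro Hfh; simpl; [lra|].
pose proof (IH ltac:(intros i Hi; apply Hfh; lia)); pose proof (Hfh n ltac:(lia)); lra.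
Qed.

Lemma abs_cont_of_deriv (L B : R) (f df : R -> R) : 0 < B ->
  (forall x, in0L L x -> has_deriv_in L f x (df x)) ->
  (forall x, in0L L x -> Rabs (df x) <= B) -> abs_cont_on L f.
Proof.
intros HB Hd Hb eps Heps.
exists (eps / B); split; [apply Rdiv_lt_0_compat; assumption|].
intros n s t Hst _ Hsum; apply Rlt_div_r in Hsum; [|exact HB].
eapply Rle_lt_trans; [|rewrite Rmult_comm in Hsum; exact Hsum].
apply fsum_scal_le; intros i Hi; destruct (Hst i Hi) as [H1 H2].
destruct (mvt_in L f df (s i) (t i) Hd ltac:(lra) ltac:(lra) H2) as [c [Hc Heq]].
rewrite Heq, Rabs_mult, (Rabs_pos_eq (t i - s i)) by lra.
apply Rmult_le_compat_r; [lra|apply Hb; unfold in0L; lra].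
Qed.

Lemma ae_on_all (L : R) (P : R -> Prop) : (forall x, in0L L x -> P x) -> ae_on L P.
Proof.
intro HP; exists (fun _ => False); split; [|intros x Hx _; apply HP, Hx].
intros eps Heps; exists (fun _ => 0), (fun _ => 0).
split; [intro; lra|split; [intros x []|]].
intro n; assert (H : fsum n (fun _ => 0 - 0) <= 0 * fsum n (fun _ => 0)).
{ apply fsum_scal_le; intros; lra. }
lra.
Qed.

(** At an end point only increments pointing into the interval are available, so the sign of [h]
    depends on the half in which [x] lies. As a result [p] is determined by [u] on [0, L]. *)
Lemma has_deriv_in_unique (L : R) (u v : R -> R) (x l l' : R) : 0 < L -> in0L L x ->
  (forall y, in0L L y -> u y = v y) ->
  has_deriv_in L u x l -> has_deriv_in L v x l' -> l = l'.
Proof.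
intros HL Hx Huv Hl Hl'.
apply NNPP; intro Hne.
assert (Hg : 0 < Rabs (l - l') / 2) by (pose proof (Rabs_pos_lt (l - l') ltac:(lra)); lra).
destruct (Hl _ Hg) as [d [Hd H1]]; destruct (Hl' _ Hg) as [d' [Hd' H2]].
set (m := Rmin (Rmin (d / 2) (d' / 2)) (L / 2)).
assert (Hm : 0 < m) by (repeat apply Rmin_pos; lra).
assert (m <= d / 2) by (eapply Rle_trans; apply Rmin_l).
assert (m <= d' / 2) by (eapply Rle_trans; [apply Rmin_l|apply Rmin_r]).
assert (m <= L / 2) by apply Rmin_r.
unfold in0L in *.
assert (Hh : exists h, h <> 0 /\ Rabs h = m /\ 0 <= x + h <= L).
{ destruct (Rle_lt_dec x (L / 2)).
  - exists m; rewrite Rabs_pos_eq by lra; lra.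
  - exists (- m); rewrite Rabs_Ropp, Rabs_pos_eq by lra; lra. }
destruct Hh as [h [Hh0 [Hhm HhL]]].
specialize (H1 h Hh0 ltac:(lra) HhL); specialize (H2 h Hh0 ltac:(lra) HhL).
rewrite !Huv in H1 by lra.
set (q := (v (x + h) - v x) / h) in *.
assert (Rabs (l - l') <= Rabs (q - l) + Rabs (q - l')); [|lra].
replace (l - l') with (- (q - l) + (q - l')) by ring.
eapply Rle_trans; [apply Rabs_triang|]; rewrite Rabs_Ropp; lra.
Qed.

Lemma cont_on_restrict (K : R) (k : R -> R) :
  cont_on (fun s => 0 <= s) k -> cont_on (in0L K) k.
Proof.
intros Hk x Hx eps Heps; destruct (Hk x (proj1 Hx) eps Heps) as [d [Hd H]].
exists d; split; [exact Hd|]; intros y Hy; apply H, (proj1 Hy).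
Qed.

(** Near 0 the hypothesis on [k s / s] gives the bound; beyond [d] a bound [B] on the values is at
    most [B / d] times the argument. The map [r] stands for a truncation. *)
Lemma linear_near_0_comp (k r : R -> R) : cont_on (fun s => 0 <= s) k ->
  (forall s, 0 <= s -> 0 <= k s) -> k 0 = 0 ->
  (exists C del, 0 < del /\ forall s, 0 < s < del -> k s / s <= C) ->
  (forall s, 0 <= r s <= Rabs s) -> linear_near_0 (fun s => k (r s)).
Proof.
intros Hk Hk0 Hkz [C [d [Hd HC]]] Hr V.
destruct (Rlt_le_dec V 0) as [HV|HV].
{ exists 0; split; [lra|]; intros s Hs; pose proof (Rabs_pos s); lra. }
destruct (cont_on_bounded V k HV (cont_on_restrict V k Hk)) as [B [HB HBk]].
assert (HBd : 0 < B / d) by (apply Rdiv_lt_0_compat; assumption).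
exists (Rabs C + B / d); pose proof (Rabs_pos C); split; [lra|].
intros s Hs; destruct (Hr s) as [Hr0 Hrs].
rewrite (Rabs_pos_eq (k (r s))) by (apply Hk0; exact Hr0).
apply Rle_trans with ((Rabs C + B / d) * r s); [|apply Rmult_le_compat_l; lra].
destruct (Req_dec (r s) 0) as [->|Hne]; [rewrite Hkz; lra|].
destruct (Rlt_le_dec (r s) d) as [Hlt|Hge].
- specialize (HC (r s) ltac:(lra)); apply Rle_div_l in HC; [|lra].
  pose proof (Rle_abs C); nra.
- specialize (HBk (r s) ltac:(unfold in0L; lra)); apply Rabs_le_between in HBk.
  assert (B <= B / d * r s).
  { replace B with (B / d * d) at 1 by (field; lra); apply Rmult_le_compat_l; lra. }
  nra.
Qed.

Lemma ivp_ext (L alpha beta : R) (f f' : R -> R -> R) (s : R) (u p : R -> R) :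
  (forall x, in0L L x -> f x (u x) = f' x (u x)) ->
  ivp L alpha beta f s u p -> ivp L alpha beta f' s u p.
Proof.
intros Hff [Hu [Hp H0]]; split; [exact Hu|split; [|exact H0]].
intros x Hx; rewrite <- Hff by exact Hx; apply Hp, Hx.
Qed.

Lemma field_bounded (a b G H : R -> R) (mu A B C D x u : R) :
  Rabs (a x) <= A -> Rabs (b x) <= B -> Rabs (G u) <= C -> Rabs (H u) <= D ->
  Rabs (field a b G H mu x u) <= A * C + Rabs mu * B * D.
Proof.
intros Ha Hb HG HH; unfold field.
eapply Rle_trans; [apply Rabs_triang|]; rewrite Rabs_Ropp, !Rabs_mult.
pose proof (Rabs_pos (a x)); pose proof (Rabs_pos (b x)); pose proof (Rabs_pos (G u)).
pose proof (Rabs_pos (H u)); pose proof (Rabs_pos mu).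
apply Rplus_le_compat; apply Rmult_le_compat; try assumption.
- apply Rmult_le_pos; assumption.
- apply Rmult_le_compat_l; assumption.
Qed.

Lemma field_continuous (a b G H : R -> R) (mu : R) : continuity a -> continuity b ->
  continuity G -> continuity H -> forall x u eps, 0 < eps -> exists del, 0 < del /\
  forall x' u', Rabs (x' - x) < del -> Rabs (u' - u) < del ->
    Rabs (field a b G H mu x' u' - field a b G H mu x u) < eps.
Proof.
intros Ha Hb HG HH x u eps Heps.
assert (Hc : continuity_2d_pt (field a b G H mu) x u).
{ apply continuity_2d_pt_plus.
  - apply continuity_2d_pt_opp, continuity_2d_pt_mult.
    + apply (continuity_1d_2d_pt_comp a (fun t _ => t)); [apply Ha|apply continuity_2d_pt_id1].
    + apply (continuity_1d_2d_pt_comp G (fun _ v => v)); [apply HG|apply continuity_2d_pt_id2].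
  - apply continuity_2d_pt_mult; [apply continuity_2d_pt_mult|].
    + apply continuity_2d_pt_const.
    + apply (continuity_1d_2d_pt_comp b (fun t _ => t)); [apply Hb|apply continuity_2d_pt_id1].
    + apply (continuity_1d_2d_pt_comp H (fun _ v => v)); [apply HH|apply continuity_2d_pt_id2]. }
destruct (Hc (mkposreal eps Heps)) as [d Hd].
exists d; split; [apply cond_pos|exact Hd].
Qed.

(** The maximum is 1-Lipschitz in the sup norm. The cases used for shooting are [e = 1] and
    [e = -1], one for each side of the barrier. *)
Lemma max_shoot_lip (gamma delta e r a b c d a' b' c' d' : R) : 0 <= gamma -> 0 <= delta ->
  Rabs e <= 1 ->
  Rabs (Rmax (gamma * c + delta * d) (e * (Rmax a b - r)) -
        Rmax (gamma * c' + delta * d') (e * (Rmax a' b' - r))) <=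
  (gamma + delta + 1) * (Rabs (a - a') + Rabs (b - b') + Rabs (c - c') + Rabs (d - d')).
Proof.
intros Hg Hd He.
assert (Hmax : forall x y x' y', Rabs (Rmax x y - Rmax x' y') <= Rmax (Rabs (x - x')) (Rabs (y - y'))).
{ intros; unfold Rmax, Rabs; repeat destruct (Rle_dec _ _); repeat destruct (Rcase_abs _); lra. }
assert (Hsum : forall x y, 0 <= x -> 0 <= y -> Rmax x y <= x + y).
{ intros; apply Rmax_lub; lra. }
eapply Rle_trans; [apply Hmax|].
pose proof (Rabs_pos (a - a')); pose proof (Rabs_pos (b - b')).
pose proof (Rabs_pos (c - c')); pose proof (Rabs_pos (d - d')).
assert (0 <= gamma * (Rabs (a - a') + Rabs (b - b') + Rabs (d - d'))) by (apply Rmult_le_pos; lra).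
assert (0 <= delta * (Rabs (a - a') + Rabs (b - b') + Rabs (c - c'))) by (apply Rmult_le_pos; lra).
assert (0 <= gamma * Rabs (c - c')) by (apply Rmult_le_pos; lra).
assert (0 <= delta * Rabs (d - d')) by (apply Rmult_le_pos; lra).
apply Rmax_lub.
- replace (gamma * c + delta * d - (gamma * c' + delta * d'))
    with (gamma * (c - c') + delta * (d - d')) by ring.
  eapply Rle_trans; [apply Rabs_triang|].
  rewrite !Rabs_mult, (Rabs_pos_eq gamma), (Rabs_pos_eq delta) by assumption; lra.
- replace (e * (Rmax a b - r) - e * (Rmax a' b' - r)) with (e * (Rmax a b - Rmax a' b')) by ring.
  rewrite Rabs_mult.
  pose proof (Rabs_pos (Rmax a b - Rmax a' b')).
  apply Rle_trans with (1 * Rabs (Rmax a b - Rmax a' b')); [apply Rmult_le_compat_r; lra|].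
  pose proof (Hmax a b a' b'); pose proof (Hsum (Rabs (a - a')) (Rabs (b - b'))); lra.
Qed.

(** * Bounds independent of [mu], the choice of constants and the three solutions *)

Section Main.

Context (L alpha beta gamma delta : R) (a b g k : R -> R)
  (HL : 0 < L)
  (Hal : 0 <= alpha) (Hbe : 0 <= beta) (Hga : 0 <= gamma) (Hde : 0 <= delta)
  (Hpar : gamma * beta + alpha * gamma + alpha * delta > 0)
  (Ha_cont : cont_on (in0L L) a) (Hb_cont : cont_on (in0L L) b)
  (Ha_nn : forall x, in0L L x -> 0 <= a x)
  (Hb_nn : forall x, in0L L x -> 0 <= b x)
  (tau sigma : R) (Htau : 0 < tau) (Hts : tau < sigma) (HsL : sigma < L)
  (Ha_pos : forall x, (0 < x < tau \/ sigma < x < L) -> 0 < a x)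
  (Ha_0 : forall x, tau <= x <= sigma -> a x = 0)
  (Hb_pos : forall x, tau < x < sigma -> 0 < b x)
  (Hb_0 : forall x, (0 <= x <= tau \/ sigma <= x <= L) -> b x = 0)
  (Hg_cont : cont_on (fun s => 0 <= s) g) (Hk_cont : cont_on (fun s => 0 <= s) k)
  (Hg_nn : forall s, 0 <= s -> 0 <= g s) (Hk_nn : forall s, 0 <= s -> 0 <= k s)
  (Hg0 : g 0 = 0) (Hk0 : k 0 = 0)
  (Hk_pos : forall s, 0 < s -> 0 < k s)
  (Hg_zero : forall eps, 0 < eps -> exists del, 0 < del /\
       forall s, 0 < s < del -> g s / s < eps)
  (Hg_inf : forall M, exists R0, forall s, R0 < s -> M < g s / s)
  (Hk_zero : exists C del, 0 < del /\ forall s, 0 < s < del -> k s / s <= C).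

Let G (s : R) : R := g (Rmax 0 s).

(** What is kept of [k]. The bounds below hold for all such [H] at once, since the level at which
    [k] is truncated is chosen only after them. *)
Let admissible (H : R -> R) : Prop :=
  (forall s, 0 <= H s) /\ (forall s, s <= 0 -> H s = 0) /\ linear_near_0 H.

Let sol (H : R -> R) (mu : R) : R -> (R -> R) -> (R -> R) -> Prop :=
  ivp L alpha beta (field a b G H mu).

Lemma G_ge0 (s : R) : 0 <= G s.
Proof. apply Hg_nn, Rmax_l. Qed.

Lemma G_neg (s : R) : s <= 0 -> G s = 0.
Proof. intro Hs; unfold G; rewrite Rmax_left by exact Hs; exact Hg0. Qed.

Lemma G_pos (s : R) : 0 <= s -> G s = g s.
Proof. intro Hs; unfold G; rewrite Rmax_right by exact Hs; reflexivity. Qed.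

Lemma G_lin : linear_near_0 G.
Proof.
apply (linear_near_0_comp g (Rmax 0)); try assumption.
- destruct (Hg_zero 1 Rlt_0_1) as [d [Hd H]]; exists 1, d; split; [exact Hd|].
  intros s Hs; apply Rlt_le, H, Hs.
- intro s; unfold Rmax, Rabs; destruct (Rle_dec 0 s), (Rcase_abs s); lra.
Qed.

Lemma alpha_beta_pos : 0 < alpha + beta.
Proof.
apply Rnot_le_lt; intro Hn; assert (E1 : alpha = 0) by lra; assert (E2 : beta = 0) by lra.
rewrite E1, E2 in Hpar; lra.
Qed.

Lemma gamma_delta_pos : 0 < gamma + delta.
Proof.
apply Rnot_le_lt; intro Hn; assert (E1 : gamma = 0) by lra; assert (E2 : delta = 0) by lra.
rewrite E1, E2 in Hpar; lra.
Qed.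

Lemma bound_nonneg (f : R -> R) : cont_on (in0L L) f -> (forall x, in0L L x -> 0 <= f x) ->
  exists A, 0 < A /\ forall x, in0L L x -> 0 <= f x <= A.
Proof.
intros Hf Hf0; destruct (cont_on_bounded L f (Rlt_le _ _ HL) Hf) as [A [HA Hb]].
exists A; split; [exact HA|]; intros x Hx; split; [apply Hf0, Hx|].
pose proof (Hb x Hx); pose proof (Rle_abs (f x)); lra.
Qed.

Lemma pos_on_middle (f : R -> R) (c d : R) : cont_on (in0L L) f -> 0 <= c -> c < d -> d <= L ->
  (forall x, c < x < d -> 0 < f x) ->
  exists m, 0 < m /\ forall x, c + (d - c) / 4 <= x <= d - (d - c) / 4 -> m <= f x.
Proof.
intros Hf Hc Hcd Hd Hpos.
apply (cont_on_pos_min (in0L L)); [lra| |exact Hf|]; intros t Ht.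
- unfold in0L; lra.
- apply Hpos; lra.
Qed.

(** As [b] vanishes on [c, d], neither [mu] nor [H] acts there, so [K] can be chosen before both. *)
Lemma superlinear_bound (c d : R) : 0 <= c -> c < d -> d <= L ->
  (forall x, c < x < d -> 0 < a x) -> (forall x, c <= x <= d -> b x = 0) ->
  exists K, 0 < K /\ forall H mu s u p, admissible H -> 0 <= mu -> sol H mu s u p ->
    (forall x, c <= x <= d -> 0 <= u x) -> forall x, c <= x <= d -> u x <= K.
Proof.
intros Hc Hcd Hd Hpos Hb0.
destruct (pos_on_middle a c d Ha_cont Hc Hcd Hd Hpos) as [a0 [Ha0 Hlow]].
destruct (bound_nonneg a Ha_cont Ha_nn) as [A [_ HA]].
destruct (bound_nonneg b Hb_cont Hb_nn) as [B [_ HB]].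
assert (Hl : 0 < a0 * (d - c) ^ 2).
{ apply Rmult_lt_0_compat; [exact Ha0|]; apply pow_lt; lra. }
(* Any number above the 64 required by [sol_large] would do. *)
set (M := 65 / (a0 * (d - c) ^ 2)).
destruct (Hg_inf M) as [R0 HR0].
pose proof (Rmax_l 0 R0) as Hm1; pose proof (Rmax_r 0 R0) as Hm2.
exists (4 * (Rmax 0 R0 + 1)); split; [lra|].
intros H mu s u p [HH1 [HH2 HH3]] Hmu Hsol Hu.
apply (sol_large L alpha beta HL a b G H mu A HA G_ge0 s u p c d a0 M (Rmax 0 R0 + 1)); try assumption.
- lra.
- intros t Ht; rewrite G_pos by lra; specialize (HR0 t ltac:(lra)).
  apply Rlt_div_r in HR0; lra.
- replace (a0 * M * (d - c) ^ 2) with 65; [lra|].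
  unfold M; field; split; [lra|]; apply Rgt_not_eq; exact Ha0.
Qed.

Lemma a_priori : exists K, 0 < K /\ forall H mu s u p, admissible H -> 0 <= mu ->
  sol H mu s u p ->
  ((forall x, 0 <= x <= tau -> 0 <= u x) -> forall x, 0 <= x <= tau -> u x <= K) /\
  ((forall x, sigma <= x <= L -> 0 <= u x) -> forall x, sigma <= x <= L -> u x <= K).
Proof.
destruct (superlinear_bound 0 tau ltac:(lra) Htau ltac:(lra)) as [K1 [HK1 H1]].
{ intros x Hx; apply Ha_pos; lra. }
{ intros x Hx; apply Hb_0; lra. }
destruct (superlinear_bound sigma L ltac:(lra) HsL ltac:(lra)) as [K2 [HK2 H2]].
{ intros x Hx; apply Ha_pos; lra. }
{ intros x Hx; apply Hb_0; lra. }
exists (K1 + K2); split; [lra|]; intros H mu s u p HH Hmu Hsol; split; intros Hu x Hx.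
- pose proof (H1 H mu s u p HH Hmu Hsol Hu x Hx); lra.
- pose proof (H2 H mu s u p HH Hmu Hsol Hu x Hx); lra.
Qed.

(** If [u] were nonnegative on [0, tau], it would be at most [K] there and [p] could fall by at most
    [A * M * L], whatever [s] is; then [u tau] would exceed [K] because [s * (beta + alpha * tau)]
    is large. So [u] turns negative on [0, tau] and remains so, with negative slope. *)
Lemma large_start : exists S, 0 < S /\ forall H mu s u p, admissible H -> 0 <= mu ->
  S <= s -> sol H mu s u p ->
  u sigma < 0 /\ p sigma < 0 /\ gamma * u L + delta * p L < 0.
Proof.
destruct a_priori as [K [HK Hap]].
destruct (bound_nonneg a Ha_cont Ha_nn) as [A [HA0 HA]].
destruct (bound_nonneg b Hb_cont Hb_nn) as [B [_ HB]].
destruct (cont_on_bounded K g (Rlt_le _ _ HK) (cont_on_restrict K g Hg_cont)) as [M [HM Hgm]].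
pose proof alpha_beta_pos as Hab; pose proof gamma_delta_pos as Hgd.
assert (HD : 0 < beta + alpha * tau).
{ destruct (Req_dec alpha 0) as [->|]; [lra|].
  assert (0 < alpha * tau) by (apply Rmult_lt_0_compat; lra); lra. }
assert (HN : 0 < K + A * M * L * tau + 1).
{ assert (0 < A * M * L * tau) by (repeat apply Rmult_lt_0_compat; lra); lra. }
exists ((K + A * M * L * tau + 1) / (beta + alpha * tau)).
split; [apply Rdiv_lt_0_compat; assumption|].
intros H mu s u p [HH1 [HH2 HH3]] Hmu Hs Hsol.
assert (Hs0 : 0 < s).
{ eapply Rlt_le_trans; [|exact Hs]; apply Rdiv_lt_0_compat; assumption. }
apply Rle_div_l in Hs; [|exact HD].
pose proof Hsol as [Hu [Hp [Hu0 Hp0]]].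
assert (Hex : exists x, 0 <= x <= tau /\ u x < 0).
{ apply NNPP; intro Hn.
  assert (Hge : forall x, 0 <= x <= tau -> 0 <= u x).
  { intros x Hx; apply Rnot_lt_le; intro Hlt; apply Hn; exists x; tauto. }
  destruct (Hap H mu s u p (conj HH1 (conj HH2 HH3)) Hmu Hsol) as [HK1 _].
  specialize (HK1 Hge).
  assert (Hpl : forall x, 0 <= x <= tau -> alpha * s - A * M * L <= p x).
  { intros x Hx.
    assert (HxL : p 0 + - (A * M) * (x - 0) <= p x).
    { apply (deriv_ge L p _ 0 x (- (A * M)) Hp); try lra; intros t Ht.
      unfold field; rewrite (Hb_0 t) by lra.
      pose proof (HA t ltac:(unfold in0L; lra)).
      pose proof (HK1 t ltac:(lra)); pose proof (Hge t ltac:(lra)).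
      rewrite G_pos by assumption.
      pose proof (Hgm (u t) ltac:(unfold in0L; lra)); pose proof (Rle_abs (g (u t))).
      pose proof (Hg_nn (u t) ltac:(lra)).
      assert (a t * g (u t) <= A * M) by (apply Rmult_le_compat; lra); lra. }
    assert (A * M * x <= A * M * L) by (apply Rmult_le_compat_l; [apply Rmult_le_pos; lra|lra]).
    lra. }
  assert (u 0 + (alpha * s - A * M * L) * (tau - 0) <= u tau).
  { apply (deriv_ge L u p); try lra; assumption. }
  pose proof (HK1 tau ltac:(lra)); lra. }
destruct Hex as [x [Hx Hux]].
assert (Hx0 : 0 < x).
{ destruct (Req_dec x 0) as [->|]; [|lra].
  assert (0 <= beta * s) by (apply Rmult_le_pos; lra); lra. }
pose proof (fun y => sol_nonpos_after L alpha beta HL Hbe Hab a b G H mu A B Hmu HA HB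
  G_neg G_lin HH2 HH3 s u p x y Hsol Hs0 Hx0) as Hafter.
destruct (Hafter sigma ltac:(lra) ltac:(lra)) as [H1 [_ H2]].
destruct (Hafter L ltac:(lra) ltac:(lra)) as [H3 [_ H4]].
specialize (H2 ltac:(lra)); specialize (H4 ltac:(lra)).
split; [exact H2|split; [exact H1|]].
destruct (Req_dec gamma 0) as [->|]; nra.
Qed.

(** Here [w] is an upper bound for [v], which may be negative: along a solution only upper bounds on
    [u] are at hand. *)
Lemma G_small (eps : R) : 0 < eps -> exists d, 0 < d /\
  forall v w, 0 <= w -> v <= w -> w < d -> G v <= eps * w.
Proof.
intro Heps; destruct (Hg_zero eps Heps) as [d [Hd Hz]].
exists d; split; [exact Hd|]; intros v w Hw Hvw Hwd.
destruct (Rle_lt_dec v 0) as [Hv|Hv].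
- rewrite G_neg by exact Hv; apply Rmult_le_pos; lra.
- rewrite G_pos by lra; specialize (Hz v ltac:(lra)).
  apply Rlt_div_l in Hz; [nra|exact Hv].
Qed.

(** On [0, tau] the solution stays below [s * E], where [g] is so small that [u tau], and likewise
    the tangent at [tau] followed to [sigma], lose at most [s * D / 2] against the line
    [s * (beta + alpha * x)]. These two heights are what [sol_grow_right] asks for. *)
Lemma small_start (S : R) : 0 < S -> exists s q, 0 < s < S /\ 0 < q /\
  forall H mu u p, admissible H -> 0 <= mu -> sol H mu s u p ->
  q <= u tau /\ q <= u tau + p tau * (sigma - tau).
Proof.
intro HS.
destruct (bound_nonneg a Ha_cont Ha_nn) as [A [HA0 HA]].
destruct (bound_nonneg b Hb_cont Hb_nn) as [B [_ HB]].
pose proof alpha_beta_pos as Hab.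
assert (HD : 0 < beta + alpha * tau).
{ destruct (Req_dec alpha 0) as [->|]; [lra|].
  assert (0 < alpha * tau) by (apply Rmult_lt_0_compat; lra); lra. }
set (D := beta + alpha * tau) in *; set (E := beta + alpha * L).
assert (HDE : D <= E) by (unfold D, E; assert (alpha * tau <= alpha * L)
  by (apply Rmult_le_compat_l; lra); lra).
assert (HEL : 0 < A * E * L ^ 2).
{ repeat apply Rmult_lt_0_compat; lra. }
(* Chosen so that the loss bound [A * (eps * (s * E)) * L ^ 2] equals [s * D / 2]. *)
destruct (G_small (D / (2 * (A * E * L ^ 2)))) as [d [Hd HG]].
{ apply Rdiv_lt_0_compat; lra. }
set (eps := D / (2 * (A * E * L ^ 2))) in *.
assert (Heps : 0 < eps) by (apply Rdiv_lt_0_compat; lra).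
assert (HepsD : A * eps * E * L ^ 2 = D / 2).
{ unfold eps; field; repeat split; lra. }
(* The second entry gives [s * E <= d / 2], inside the range where the bound on [G] holds. *)
set (s := Rmin (S / 2) (d / (2 * E))).
assert (Hs : 0 < s) by (apply Rmin_pos; [lra|]; apply Rdiv_lt_0_compat; lra).
assert (HsS : s <= S / 2) by apply Rmin_l.
assert (Hsd : s <= d / (2 * E)) by apply Rmin_r.
apply Rle_div_r in Hsd; [|lra].
assert (HsE : 0 < s * E) by (apply Rmult_lt_0_compat; lra).
exists s, (s * D / 2); split; [lra|split; [assert (0 < s * D)
  by (apply Rmult_lt_0_compat; lra); lra|]].
intros H mu u p [HH1 [HH2 HH3]] Hmu Hsol.
pose proof Hsol as [Hu [Hp [Hu0 Hp0]]].
assert (Hcv : forall x y, 0 <= x -> x <= y -> y <= tau ->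
  p y <= p x /\ p y * (y - x) <= u y - u x <= p x * (y - x)).
{ apply (sol_concave L alpha beta a b G H mu A HA G_ge0 s u p); try lra; [exact Hsol|].
  intros x Hx; apply Hb_0; lra. }
assert (Hup : forall x, 0 <= x <= tau -> u x <= s * E).
{ intros x Hx; destruct (Hcv 0 x ltac:(lra) ltac:(lra) ltac:(lra)) as [_ [_ H1]].
  rewrite Hu0, Hp0 in H1.
  assert (alpha * s * (x - 0) <= alpha * s * L) by (apply Rmult_le_compat_l;
    [apply Rmult_le_pos; lra|lra]).
  unfold E; lra. }
assert (Hpl : p 0 + - (A * (eps * (s * E))) * (tau - 0) <= p tau).
{ apply (deriv_ge L p _ 0 tau _ Hp); try lra; intros t Ht.
  unfold field; rewrite (Hb_0 t) by lra.
  pose proof (HA t ltac:(unfold in0L; lra)).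
  pose proof (HG (u t) (s * E) ltac:(lra) (Hup t ltac:(lra)) ltac:(lra)).
  assert (a t * G (u t) <= A * (eps * (s * E))); [|lra].
  apply Rmult_le_compat; try lra; apply G_ge0. }
destruct (Hcv 0 tau ltac:(lra) ltac:(lra) ltac:(lra)) as [_ [Hlow _]].
assert (Hloss : forall y, 0 <= y <= L -> A * (eps * (s * E)) * tau * y <= s * D / 2).
{ intros y Hy.
  replace (s * D / 2) with (A * (eps * (s * E)) * (L * L))
    by (replace (s * D / 2) with (s * (D / 2)) by field; rewrite <- HepsD; ring).
  rewrite Rmult_assoc; apply Rmult_le_compat_l.
  - apply Rmult_le_pos; [lra|]; apply Rmult_le_pos; lra.
  - apply Rmult_le_compat; lra. }
rewrite Hp0 in Hpl; rewrite Hu0 in Hlow.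
pose proof (Hloss tau ltac:(lra)); pose proof (Hloss sigma ltac:(lra)).
assert (H3 : (alpha * s - A * (eps * (s * E)) * tau) * tau <= p tau * tau)
  by (apply Rmult_le_compat_r; lra).
assert (H4 : (alpha * s - A * (eps * (s * E)) * tau) * sigma <= p tau * sigma)
  by (apply Rmult_le_compat_r; lra).
assert (alpha * s * tau <= alpha * s * sigma) by (apply Rmult_le_compat_l;
  [apply Rmult_le_pos; lra|lra]).
replace (s * D / 2) with (s * D - s * D / 2) by field.
unfold D in *; split; lra.
Qed.

(** On [sigma, L] concavity gives [u <= r * (1 + L)], and for this small [r] the behaviour of [g] at
    0 limits the loss of slope to [c * r / 2]. Hence [p L > 0] and [u L > 0]. *)
Lemma small_end (c : R) : 0 < c -> exists r, 0 < r /\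
  forall H mu s u p, admissible H -> 0 <= mu -> sol H mu s u p ->
  0 < u sigma <= r -> c * r <= p sigma <= r -> 0 < gamma * u L + delta * p L.
Proof.
intro Hc.
destruct (bound_nonneg a Ha_cont Ha_nn) as [A [HA0 HA]].
destruct (bound_nonneg b Hb_cont Hb_nn) as [B [_ HB]].
assert (HAL : 0 < A * (1 + L) * L) by (repeat apply Rmult_lt_0_compat; lra).
destruct (G_small (c / (2 * (A * (1 + L) * L)))) as [d [Hd HG]].
{ apply Rdiv_lt_0_compat; lra. }
set (eps := c / (2 * (A * (1 + L) * L))) in *.
assert (Heps : 0 < eps) by (apply Rdiv_lt_0_compat; lra).
assert (HepsD : A * eps * (1 + L) * L = c / 2).
{ unfold eps; field; repeat split; lra. }
exists (d / (2 * (1 + L))).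
set (r := d / (2 * (1 + L))).
assert (Hr : 0 < r) by (apply Rdiv_lt_0_compat; lra).
assert (Hrd : r * (1 + L) = d / 2) by (unfold r; field; lra).
split; [exact Hr|].
intros H mu s u p [HH1 [HH2 HH3]] Hmu Hsol Hus Hps.
pose proof Hsol as [Hu [Hp _]].
assert (Hcv : forall x y, sigma <= x -> x <= y -> y <= L ->
  p y <= p x /\ p y * (y - x) <= u y - u x <= p x * (y - x)).
{ apply (sol_concave L alpha beta a b G H mu A HA G_ge0 s u p); try lra; [exact Hsol|].
  intros x Hx; apply Hb_0; lra. }
assert (Hup : forall x, sigma <= x <= L -> u x <= r * (1 + L)).
{ intros x Hx; destruct (Hcv sigma x ltac:(lra) ltac:(lra) ltac:(lra)) as [_ [_ H1]].
  assert (p sigma * (x - sigma) <= r * L).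
  { assert (0 < c * r) by (apply Rmult_lt_0_compat; lra).
    apply Rmult_le_compat; lra. }
  lra. }
assert (Hpl : p sigma + - (A * (eps * (r * (1 + L)))) * (L - sigma) <= p L).
{ apply (deriv_ge L p _ sigma L _ Hp); try lra; intros t Ht.
  unfold field; rewrite (Hb_0 t) by lra.
  pose proof (HA t ltac:(unfold in0L; lra)).
  pose proof (HG (u t) (r * (1 + L)) ltac:(lra) (Hup t ltac:(lra)) ltac:(lra)).
  assert (a t * G (u t) <= A * (eps * (r * (1 + L)))); [|lra].
  apply Rmult_le_compat; try lra; apply G_ge0. }
assert (Hloss : A * (eps * (r * (1 + L))) * (L - sigma) <= c * r / 2).
{ replace (c * r / 2) with (A * (eps * (r * (1 + L))) * L)
    by (replace (c * r / 2) with (r * (c / 2)) by field; rewrite <- HepsD; ring).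
  apply Rmult_le_compat_l; [|lra].
  apply Rmult_le_pos; [lra|]; apply Rmult_le_pos; lra. }
assert (Hcr : 0 < c * r) by (apply Rmult_lt_0_compat; lra).
assert (HpL : 0 < p L) by lra.
destruct (Hcv sigma L ltac:(lra) ltac:(lra) ltac:(lra)) as [_ [H1 _]].
assert (HuL : 0 < u L) by (assert (0 < p L * (L - sigma)) by (apply Rmult_lt_0_compat; lra); lra).
pose proof gamma_delta_pos.
destruct (Req_dec gamma 0) as [->|]; nra.
Qed.

(** Freezes [k] above [K] and extends it by [k 0 = 0] below 0, which makes it bounded whatever its
    growth. *)
Let Hcl (K : R) (t : R) : R := k (clamp K t).

Lemma Hcl_admissible (K : R) : 0 <= K -> admissible (Hcl K).
Proof.
intro HK; unfold Hcl; split; [|split].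
- intro s; apply Hk_nn, clamp_in, HK.
- intros s Hs; replace (clamp K s) with 0; [exact Hk0|].
  unfold clamp; symmetry; apply Rmax_left; eapply Rle_trans; [apply Rmin_l|exact Hs].
- apply (linear_near_0_comp k (clamp K)); try assumption.
  intro s; split; [apply clamp_in, HK|].
  unfold clamp, Rmax, Rmin, Rabs; repeat destruct (Rle_dec _ _); destruct (Rcase_abs s); lra.
Qed.

Lemma zero_start (H : R -> R) (mu : R) (u p : R -> R) : admissible H -> 0 <= mu ->
  sol H mu 0 u p -> forall x, in0L L x -> u x = 0 /\ p x = 0.
Proof.
intros [_ [_ HH3]] Hmu Hsol.
destruct (bound_nonneg a Ha_cont Ha_nn) as [A [_ HA]].
destruct (bound_nonneg b Hb_cont Hb_nn) as [B [_ HB]].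
pose proof Hsol as [_ [_ [Hu0 Hp0]]]; rewrite Rmult_0_r in Hu0, Hp0.
apply (sol_zero L alpha beta HL a b G H mu A B Hmu HA HB G_lin HH3 0 u p 0 Hsol);
  [unfold in0L; lra|exact Hu0|exact Hp0].
Qed.

(** The order of choice matters: [K0], [S], [ss], [q] and [r] come from bounds valid for all [mu]
    and all truncations, then [K] and the lower bound [kap] of [k] on [q', K] are fixed, and [mu0]
    comes last. *)
Lemma shooting_constants : exists K r ss S mu0, 0 < K /\ 0 < r /\ 0 < ss < S /\ 0 < mu0 /\
  forall mu, mu0 < mu -> forall s u p, 0 <= s -> sol (Hcl K) mu s u p ->
    (s = ss -> r < u sigma /\ gamma * u L + delta * p L < 0) /\
    (s = S -> u sigma < 0 /\ p sigma < 0 /\ gamma * u L + delta * p L < 0) /\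
    (Rmax (u sigma) (p sigma) = r -> 0 < gamma * u L + delta * p L) /\
    (0 < s -> gamma * u L + delta * p L = 0 ->
       (forall x, 0 < x < L -> 0 < u x) /\ forall x, in0L L x -> 0 <= u x <= K).
Proof.
destruct a_priori as [K0 [HK0 Hap]].
destruct large_start as [S [HS Hlarge]].
destruct (small_start S HS) as [ss [q [Hss [Hq Hsmall]]]].
set (l := sigma - tau) in *; assert (Hl : 0 < l) by (unfold l; lra).
(* From [c <= 1], a maximum [r] with [p sigma < c * r] must be [u sigma]; from [c * (2 * l) <= 1],
   the tangent at [sigma] followed back to [tau] is then still at least [r / 2]. *)
set (c := Rmin 1 (1 / (2 * l))).
assert (Hc : 0 < c) by (apply Rmin_pos; [lra|]; apply Rdiv_lt_0_compat; lra).
assert (Hc1 : c <= 1) by apply Rmin_l.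
assert (Hcl' : c * (2 * l) <= 1).
{ apply Rle_div_r; [lra|]; apply Rmin_r. }
destruct (small_end c Hc) as [r [Hr Hend]].
(* One threshold for growth in both directions: [q] serves at [tau], [r / 2] at [sigma]. *)
set (q' := Rmin q (r / 2)).
assert (Hq' : 0 < q') by (apply Rmin_pos; lra).
assert (Hq'q : q' <= q) by apply Rmin_l.
assert (Hq'r : q' <= r / 2) by apply Rmin_r.
set (K := K0 + q').
destruct (cont_on_pos_min (fun s => 0 <= s) k q' K) as [kap [Hkap Hkapl]]; [unfold K; lra| | | |].
{ intros; lra. }
{ exact Hk_cont. }
{ intros t Ht; apply Hk_pos; lra. }
destruct (pos_on_middle b tau sigma Hb_cont ltac:(lra) Hts ltac:(lra) Hb_pos) as [b0 [Hb0 Hb0l]].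
destruct (bound_nonneg a Ha_cont Ha_nn) as [A [_ HA]].
destruct (bound_nonneg b Hb_cont Hb_nn) as [B [_ HB]].
pose proof alpha_beta_pos as Hab; pose proof gamma_delta_pos as Hgd.
assert (Hden : 0 < b0 * kap * l ^ 2).
{ repeat apply Rmult_lt_0_compat; lra. }
(* Beyond the last value the growth term [mu * b0 * kap * l ^ 2 / 8] exceeds [K0 + r]. *)
exists K, r, ss, S, (8 * (K0 + r) / (b0 * kap * l ^ 2)).
split; [unfold K; lra|split; [exact Hr|split; [exact Hss|split]]].
{ apply Rdiv_lt_0_compat; lra. }
intros mu Hmu s u p Hs Hsol.
assert (Hmu0 : 0 < mu).
{ eapply Rlt_trans; [|exact Hmu]; apply Rdiv_lt_0_compat; lra. }
assert (Hmu' : 0 <= mu) by lra.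
apply Rlt_div_l in Hmu; [|exact Hden].
assert (HKa : 0 <= K) by (unfold K; lra).
pose proof (Hcl_admissible K HKa) as Hadm.
pose proof Hadm as [HH1 [HH2 HH3]].
assert (Hkapl' : forall t, q' <= t -> kap <= Hcl K t).
{ intros t Ht; unfold Hcl; apply Hkapl.
  unfold clamp, Rmax, Rmin, K; repeat destruct (Rle_dec _ _); lra. }
destruct (Hap (Hcl K) mu s u p Hadm Hmu' Hsol) as [Hap1 Hap2].
assert (Hafter : 0 < s -> forall x y, 0 < x -> x <= y <= L -> u x <= 0 ->
  p y < 0 /\ u y <= 0 /\ (x < y -> u y < 0)).
{ intros Hs0 x y; apply (sol_nonpos_after L alpha beta HL Hbe Hab a b G (Hcl K) mu A B Hmu'
    HA HB G_neg G_lin HH2 HH3 s u p x y Hsol Hs0). }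
assert (Hpos : 0 < s -> 0 <= gamma * u L + delta * p L -> forall x, 0 < x < L -> 0 < u x).
{ intros Hs0 HF; apply (sol_pos L alpha beta HL Hbe Hab a b G (Hcl K) mu A B Hmu'
    HA HB G_neg G_lin HH2 HH3 gamma delta s u p Hsol Hs0 Hga Hde Hgd HF). }
assert (Hge : forall c' d', 0 <= c' -> c' < d' -> d' <= L ->
  (forall x, c' < x < d' -> 0 < u x) -> forall x, c' <= x <= d' -> 0 <= u x).
{ intros c' d'; apply (sol_ge0 L alpha beta a b G (Hcl K) mu s u p c' d' Hsol). }
split; [|split; [|split]].
- intro Es; rewrite Es in *.
  destruct (Hsmall (Hcl K) mu u p Hadm Hmu' Hsol) as [Hq1 Hq2].
  assert (Hbig : q' + mu * b0 * kap * (sigma - tau) ^ 2 / 8 <= u sigma).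
  { apply (sol_grow_right L alpha beta a b G (Hcl K) mu B Hmu' HB HH1 ss u p); try assumption;
      try (fold l; lra). }
  fold l in Hbig.
  assert (Hbig' : K0 + r < u sigma) by lra.
  (* A nonnegative boundary form would make [u] nonnegative on [sigma, L], hence at most [K0]
     there. *)
  split; [lra|]; apply Rnot_le_lt; intro HF.
  assert (u sigma <= K0); [|lra].
  apply Hap2; [|lra].
  apply Hge; try lra; intros x Hx; apply Hpos; lra.
- intro Es; rewrite Es in *.
  apply (Hlarge (Hcl K) mu S u p Hadm Hmu' (Rle_refl S) Hsol).
- intro Hmax.
  destruct (Req_dec s 0) as [Es|Es].
  { rewrite Es in Hsol.
    destruct (zero_start (Hcl K) mu u p Hadm Hmu' Hsol sigma) as [E1 E2]; [unfold in0L; lra|].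
    rewrite E1, E2, Rmax_left in Hmax; lra. }
  assert (Hs0 : 0 < s) by lra.
  pose proof (Rmax_l (u sigma) (p sigma)) as Hm1; pose proof (Rmax_r (u sigma) (p sigma)) as Hm2.
  rewrite Hmax in Hm1, Hm2.
  assert (Hupos : forall x, 0 < x <= sigma -> 0 < u x).
  { intros x Hx; apply Rnot_le_lt; intro Hn.
    destruct (Hafter Hs0 x sigma ltac:(lra) ltac:(lra) Hn) as [H1 [H2 _]].
    assert (Rmax (u sigma) (p sigma) <= 0) by (apply Rmax_lub; lra); lra. }
  assert (Hut : u tau <= K0).
  { apply Hap1; [|lra]; apply Hge; try lra; intros x Hx; apply Hupos; lra. }
  apply (Hend (Hcl K) mu s u p Hadm Hmu' Hsol); split; try lra; [apply Hupos; lra|].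
  (* If [p sigma] were below [c * r], growth to the left would push [u tau] above its bound [K0]. *)
  apply Rnot_lt_le; intro Hlt.
  assert (Hcr : c * r <= 1 * r) by (apply Rmult_le_compat_r; lra).
  assert (Hus : u sigma = r).
  { revert Hmax; unfold Rmax; destruct (Rle_dec _ _); lra. }
  assert (Hpl : p sigma * l <= c * r * l) by (apply Rmult_le_compat_r; lra).
  assert (Hcrl : c * (2 * l) * r <= 1 * r) by (apply Rmult_le_compat_r; lra).
  assert (Hbig : q' + mu * b0 * kap * (sigma - tau) ^ 2 / 8 <= u tau).
  { apply (sol_grow_left L alpha beta a b G (Hcl K) mu B Hmu' HB HH1 s u p); try assumption;
      try (fold l; lra). }
  fold l in Hbig; lra.
- intros Hs0 HF.
  assert (Hup : forall x, 0 < x < L -> 0 < u x) by (apply Hpos; lra).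
  split; [exact Hup|].
  pose proof (Hge 0 L ltac:(lra) HL ltac:(lra) Hup) as Hu0.
  assert (H1 : forall x, 0 <= x <= tau -> u x <= K0) by (apply Hap1; intros; apply Hu0; lra).
  assert (H2 : forall x, sigma <= x <= L -> u x <= K0) by (apply Hap2; intros; apply Hu0; lra).
  intros x Hx; split; [apply Hu0, Hx|].
  assert (u x <= K0); [|unfold K; lra].
  destruct (Rle_lt_dec x tau) as [Hxt|Hxt]; [apply H1; destruct Hx; lra|].
  destruct (Rle_lt_dec sigma x) as [Hxs|Hxs]; [apply H2; destruct Hx; lra|].
  (* On [tau, sigma] the bound is inherited from the two ends by convexity, whatever [mu] is. *)
  assert (Hcv := sol_convex L alpha beta a b G (Hcl K) mu B Hmu' HB HH1 s u p tau sigma Hsol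
    ltac:(lra) ltac:(lra) Ha_0).
  destruct (Hcv tau x ltac:(lra) ltac:(lra) ltac:(lra)) as [_ [_ H3]].
  destruct (Hcv x sigma ltac:(lra) ltac:(lra) ltac:(lra)) as [_ [H4 _]].
  pose proof (H1 tau ltac:(lra)); pose proof (H2 sigma ltac:(lra)).
  destruct (Rle_lt_dec (p x) 0); nra.
Qed.

(* Since [u'' <= mu b k(u)] and [k] is truncated, solutions are bounded above by
   some [U], so truncating [g] at [U] as well does not change them. *)
Lemma shooting_untruncated (K mu s1 s2 lam : R) (Psi : R -> R -> R -> R -> R) :
  0 < K -> 0 <= mu -> 0 <= s1 -> s1 <= s2 ->
  (forall a b c d a' b' c' d', Rabs (Psi a b c d - Psi a' b' c' d') <=
     lam * (Rabs (a - a') + Rabs (b - b') + Rabs (c - c') + Rabs (d - d'))) ->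
  (forall u p, sol (Hcl K) mu s1 u p -> 0 < Psi (u sigma) (p sigma) (u L) (p L)) ->
  (forall u p, sol (Hcl K) mu s2 u p -> Psi (u sigma) (p sigma) (u L) (p L) < 0) ->
  exists s u p, s1 <= s <= s2 /\ sol (Hcl K) mu s u p /\
    Psi (u sigma) (p sigma) (u L) (p L) = 0.
Proof.
intros HK Hmu Hs1 Hs12 HPsi H1 H2.
assert (HK0 : 0 <= K) by lra.
destruct (cont_on_bounded K k HK0 (cont_on_restrict K k Hk_cont)) as [Km [HKm Hkm]].
destruct (bound_nonneg a Ha_cont Ha_nn) as [A [HA0 HA]].
destruct (bound_nonneg b Hb_cont Hb_nn) as [B [HB0 HB]].
assert (HHm : forall t, 0 <= Hcl K t <= Km).
{ intro t; pose proof (clamp_in K t HK0) as Ht.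
  split; [apply Hk_nn, Ht|].
  pose proof (Hkm _ Ht); pose proof (Rle_abs (Hcl K t)); unfold Hcl in *; lra. }
assert (HQ : 0 <= mu * B * Km) by (repeat apply Rmult_le_pos; lra).
set (Q := mu * B * Km) in *.
(* Obtained by integrating [u'' <= Q] twice from the initial data at the largest parameter [s2]. *)
set (U := beta * s2 + (alpha * s2 + Q * L) * L).
assert (HU : 0 <= U).
{ unfold U; assert (0 <= beta * s2) by (apply Rmult_le_pos; lra).
  assert (0 <= alpha * s2) by (apply Rmult_le_pos; lra).
  assert (0 <= Q * L) by (apply Rmult_le_pos; lra).
  assert (0 <= (alpha * s2 + Q * L) * L) by (apply Rmult_le_pos; lra); lra. }
set (f := field (fun x => a (clamp L x)) (fun x => b (clamp L x)) (fun t => g (clamp U t))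
  (Hcl K) mu).
assert (Hsol : forall s u p, 0 <= s <= s2 -> ivp L alpha beta f s u p -> sol (Hcl K) mu s u p).
{ intros s u p Hs Hivp; pose proof Hivp as [Hu [Hp [Hu0 Hp0]]].
  assert (Hfle : forall x t, in0L L x -> f x t <= Q).
  { intros x t Hx; unfold f, field; rewrite clamp_id by exact Hx.
    pose proof (HA x Hx); pose proof (HB x Hx); pose proof (HHm t).
    assert (0 <= a x * g (clamp U t)) by (apply Rmult_le_pos; [lra|apply Hg_nn, clamp_in, HU]).
    assert (mu * b x * Hcl K t <= Q); [|lra].
    unfold Q; apply Rmult_le_compat; try lra; [apply Rmult_le_pos; lra|].
    apply Rmult_le_compat_l; lra. }
  assert (Has : alpha * s <= alpha * s2) by (apply Rmult_le_compat_l; lra).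
  assert (Hbs : beta * s <= beta * s2) by (apply Rmult_le_compat_l; lra).
  assert (Has0 : 0 <= alpha * s) by (apply Rmult_le_pos; lra).
  assert (Hpx : forall x, in0L L x -> p x <= alpha * s2 + Q * L).
  { intros x [Hx0 HxL].
    assert (p x <= p 0 + Q * (x - 0)).
    { apply (deriv_le L p _ 0 x Q Hp); try lra; intros t Ht; apply Hfle; unfold in0L; lra. }
    assert (Q * x <= Q * L) by (apply Rmult_le_compat_l; lra); lra. }
  assert (Hux : forall x, in0L L x -> u x <= U).
  { intros x [Hx0 HxL].
    assert (u x <= u 0 + (alpha * s2 + Q * L) * (x - 0)).
    { apply (deriv_le L u p 0 x _ Hu); try lra; intros t Ht; apply Hpx; unfold in0L; lra. }
    assert (0 <= Q * L) by (apply Rmult_le_pos; lra).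
    assert ((alpha * s2 + Q * L) * x <= (alpha * s2 + Q * L) * L)
      by (apply Rmult_le_compat_l; lra).
    unfold U; lra. }
  apply (ivp_ext L alpha beta f); [|exact Hivp].
  intros x Hx; unfold f, field, G; rewrite clamp_id by exact Hx.
  (* Below [U] the truncation of [g] reduces to [Rmax 0], that is to [G]. *)
  unfold clamp at 1; rewrite Rmin_left by (apply Hux, Hx); reflexivity. }
assert (Hba := clamp_continuity L a (Rlt_le _ _ HL) Ha_cont).
assert (Hbb := clamp_continuity L b (Rlt_le _ _ HL) Hb_cont).
assert (Hbg := clamp_continuity U g HU (cont_on_restrict U g Hg_cont)).
assert (Hbk := clamp_continuity K k HK0 (cont_on_restrict K k Hk_cont)).
destruct (cont_on_bounded U g HU (cont_on_restrict U g Hg_cont)) as [Gm [HGm Hgm]].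
destruct (shooting_ivt L alpha beta (A * Gm + Rabs mu * B * Km) f sigma lam Psi s1 s2)
  as [s [u [p [Hs [Hivp HPs]]]]]; try assumption.
- intros x t; apply field_bounded.
  + pose proof (HA _ (clamp_in L x (Rlt_le _ _ HL))); rewrite Rabs_pos_eq; lra.
  + pose proof (HB _ (clamp_in L x (Rlt_le _ _ HL))); rewrite Rabs_pos_eq; lra.
  + apply Hgm, clamp_in, HU.
  + apply Hkm, clamp_in, HK0.
- apply field_continuous; assumption.
- unfold in0L; lra.
- intros u p Hivp; apply H1, Hsol; [lra|exact Hivp].
- intros u p Hivp; apply H2, Hsol; [lra|exact Hivp].
- exists s, u, p; split; [exact Hs|split; [|exact HPs]].
  apply Hsol; [lra|exact Hivp].
Qed.

(** For values of [u] in [0, K] the extension of [g] and the truncation of [k] are invisible, so the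
    original equation holds, even at every point. Bounds on [p] and on the field give absolute
    continuity. *)
Lemma sol_is_positive_solution (K mu s : R) (u p : R -> R) : 0 < K -> 0 <= mu ->
  sol (Hcl K) mu s u p -> gamma * u L + delta * p L = 0 ->
  (forall x, 0 < x < L -> 0 < u x) -> (forall x, in0L L x -> 0 <= u x <= K) ->
  is_positive_solution L alpha beta gamma delta mu a b g k u.
Proof.
intros HK Hmu Hsol HF Hpos HuK; split; [|exact Hpos].
assert (HK0 : 0 <= K) by lra.
destruct (Hcl_admissible K HK0) as [_ [_ HH3]].
destruct (bound_nonneg a Ha_cont Ha_nn) as [A [_ HA]].
destruct (bound_nonneg b Hb_cont Hb_nn) as [B [_ HB]].
destruct (field_lin L HL a b G (Hcl K) mu A B Hmu HA HB G_lin HH3 K) as [C [HC HCl]].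
pose proof Hsol as [Hu [Hp [Hu0 Hp0]]].
destruct (cont_on_bounded L p (Rlt_le _ _ HL) (has_deriv_in_cont L p _ Hp)) as [P [HP HpP]].
exists p; split; [intros x Hx; apply HuK, Hx|].
split; [apply (abs_cont_of_deriv L P u p); assumption|].
split.
{ apply (abs_cont_of_deriv L (C * K + 1) p (fun x => field a b G (Hcl K) mu x (u x))).
  - assert (0 <= C * K) by (apply Rmult_le_pos; lra); lra.
  - exact Hp.
  - intros x Hx; pose proof (HuK x Hx) as Hux.
    assert (Hab : Rabs (u x) <= K) by (rewrite Rabs_pos_eq; lra).
    pose proof (HCl x (u x) Hx Hab).
    assert (C * Rabs (u x) <= C * K) by (apply Rmult_le_compat_l; lra); lra. }
split; [exact Hu|split; [|split; [rewrite Hu0, Hp0; ring|exact HF]]].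
apply ae_on_all; intros x Hx; pose proof (HuK x Hx) as Hux.
rewrite <- (G_pos (u x)) by apply Hux.
replace (k (u x)) with (Hcl K (u x)) by (unfold Hcl; rewrite clamp_id; [reflexivity|exact Hux]).
apply Hp, Hx.
Qed.

(** If [u] and [v] agreed on [0, L], so would their derivatives, hence the data at [sigma] and,
    since [alpha + beta > 0], the parameters. *)
Lemma sol_differ (H : R -> R) (mu s s' : R) (u p v q : R -> R) :
  sol H mu s u p -> sol H mu s' v q -> s <> s' \/ p sigma <> q sigma \/ u sigma <> v sigma ->
  differ_on L u v.
Proof.
intros [Hu [_ [Hu0 Hp0]]] [Hv [_ [Hv0 Hq0]]] Hne.
apply NNPP; intro Hn.
assert (Huv : forall x, in0L L x -> u x = v x).
{ intros x Hx; apply NNPP; intro Hd; apply Hn; exists x; tauto. }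
assert (Hpq : forall x, in0L L x -> p x = q x).
{ intros x Hx; apply (has_deriv_in_unique L u v x); try assumption; [apply Hu, Hx|apply Hv, Hx]. }
assert (H0L : in0L L 0) by (unfold in0L; lra).
assert (HsL' : in0L L sigma) by (unfold in0L; lra).
pose proof (Huv 0 H0L); pose proof (Hpq 0 H0L); pose proof alpha_beta_pos.
destruct Hne as [Hne|[Hne|Hne]]; [|exact (Hne (Hpq _ HsL'))|exact (Hne (Huv _ HsL'))].
apply Hne, (Rmult_eq_reg_l (alpha + beta)); lra.
Qed.

Lemma three_positive_solutions : exists mu0, 0 < mu0 /\ forall mu, mu0 < mu ->
  exists u1 u2 u3 : R -> R,
    is_positive_solution L alpha beta gamma delta mu a b g k u1 /\
    is_positive_solution L alpha beta gamma delta mu a b g k u2 /\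
    is_positive_solution L alpha beta gamma delta mu a b g k u3 /\
    differ_on L u1 u2 /\ differ_on L u1 u3 /\ differ_on L u2 u3.
Proof.
destruct shooting_constants as [K [r [ss [S [mu0 [HK [Hr [Hss [Hmu0 Hmain]]]]]]]]].
exists mu0; split; [exact Hmu0|]; intros mu Hmu.
specialize (Hmain mu Hmu).
assert (Hmu' : 0 <= mu) by lra.
set (F := fun u p : R -> R => gamma * u L + delta * p L).
set (Phi := fun u p : R -> R => Rmax (u sigma) (p sigma)).
assert (Hstar : forall u p, sol (Hcl K) mu ss u p -> r < Phi u p /\ F u p < 0).
{ intros u p Hsol; destruct (Hmain ss u p ltac:(lra) Hsol) as [H1 _].
  destruct (H1 eq_refl) as [H2 H3]; split; [|exact H3].
  eapply Rlt_le_trans; [exact H2|apply Rmax_l]. }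
assert (HbigS : forall u p, sol (Hcl K) mu S u p -> Phi u p < 0 /\ F u p < 0).
{ intros u p Hsol; destruct (Hmain S u p ltac:(lra) Hsol) as [_ [H1 _]].
  destruct (H1 eq_refl) as [H2 [H3 H4]]; split; [|exact H4].
  apply Rmax_lub_lt; assumption. }
assert (Hzero : forall u p, sol (Hcl K) mu 0 u p -> Phi u p = 0 /\ F u p = 0).
{ intros u p Hsol.
  pose proof (zero_start (Hcl K) mu u p (Hcl_admissible K ltac:(lra)) Hmu' Hsol) as H0.
  destruct (H0 sigma ltac:(unfold in0L; lra)) as [E1 E2].
  destruct (H0 L ltac:(unfold in0L; lra)) as [E3 E4].
  unfold Phi, F; rewrite E1, E2, E3, E4, Rmax_left; lra. }
(* A zero of the maximum with [Phi = r] is impossible because [F > 0] there; so the zero comes from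
   [F], and the side of the barrier is strict. *)
assert (Hsep : forall s u p e, 0 <= s -> sol (Hcl K) mu s u p -> e = 1 \/ e = -1 ->
  Rmax (F u p) (e * (Phi u p - r)) = 0 -> F u p = 0 /\ e * (Phi u p - r) < 0).
{ intros s u p e Hs Hsol He Hmax.
  destruct (Hmain s u p Hs Hsol) as [_ [_ [Hcrit _]]]; fold (Phi u p) (F u p) in Hcrit.
  pose proof (Rmax_l (F u p) (e * (Phi u p - r))) as Hm1.
  pose proof (Rmax_r (F u p) (e * (Phi u p - r))) as Hm2.
  rewrite Hmax in Hm1, Hm2.
  assert (Hne : Phi u p <> r) by (intro E; specialize (Hcrit E); lra).
  assert (Hlt : e * (Phi u p - r) < 0) by (destruct He as [-> | ->]; lra).
  split; [|exact Hlt].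
  revert Hmax; unfold Rmax; destruct (Rle_dec _ _); lra. }
assert (Hpos : forall s u p, 0 < s -> sol (Hcl K) mu s u p -> F u p = 0 ->
  is_positive_solution L alpha beta gamma delta mu a b g k u).
{ intros s u p Hs Hsol HF.
  destruct (Hmain s u p ltac:(lra) Hsol) as [_ [_ [_ H1]]].
  destruct (H1 Hs HF) as [H2 H3].
  apply (sol_is_positive_solution K mu s u p); assumption. }
set (Psi := fun e x y z w => Rmax (gamma * z + delta * w) (e * (Rmax x y - r))).
assert (HPsi : forall e, Rabs e <= 1 -> forall x y z w x' y' z' w',
  Rabs (Psi e x y z w - Psi e x' y' z' w') <=
  (gamma + delta + 1) * (Rabs (x - x') + Rabs (y - y') + Rabs (z - z') + Rabs (w - w'))).
{ intros e He x y z w x' y' z' w'; apply max_shoot_lip; assumption. }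
assert (E1 : Rabs 1 <= 1) by (rewrite Rabs_R1; lra).
assert (E2 : Rabs (-1) <= 1) by (rewrite Rabs_left; lra).
assert (Hchange : forall u p e, Psi e (u sigma) (p sigma) (u L) (p L) =
  Rmax (F u p) (e * (Phi u p - r))) by reflexivity.
(* The maximum is at least [r] at [s = 0], which keeps away from the trivial zero of [F]. *)
destruct (shooting_untruncated K mu 0 ss (gamma + delta + 1) (Psi (-1)) HK Hmu' ltac:(lra)
  ltac:(lra) (HPsi _ E2)) as [s1 [u1 [p1 [Hs1 [Hsol1 Hz1]]]]].
{ intros u p Hsol; rewrite Hchange; destruct (Hzero u p Hsol) as [Ez _].
  eapply Rlt_le_trans; [|apply Rmax_r]; rewrite Ez; lra. }
{ intros u p Hsol; rewrite Hchange; destruct (Hstar u p Hsol).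
  apply Rmax_lub_lt; lra. }
(* The sign is reversed: this maximum is negative at [ss] and positive at [S]. *)
destruct (shooting_untruncated K mu ss S (gamma + delta + 1)
  (fun x y z w => - Psi (-1) x y z w) HK Hmu' ltac:(lra) ltac:(lra))
  as [s2 [u2 [p2 [Hs2 [Hsol2 Hz2]]]]].
{ intros; replace (- Psi (-1) a0 b0 c d - - Psi (-1) a' b' c' d')
    with (- (Psi (-1) a0 b0 c d - Psi (-1) a' b' c' d')) by ring.
  rewrite Rabs_Ropp; apply HPsi, E2. }
{ intros u p Hsol; rewrite Hchange; destruct (Hstar u p Hsol).
  apply Ropp_0_gt_lt_contravar, Rmax_lub_lt; lra. }
{ intros u p Hsol; rewrite Hchange; destruct (HbigS u p Hsol).
  apply Ropp_lt_gt_0_contravar; eapply Rlt_le_trans; [|apply Rmax_r]; lra. }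
destruct (shooting_untruncated K mu ss S (gamma + delta + 1) (Psi 1) HK Hmu' ltac:(lra)
  ltac:(lra) (HPsi _ E1)) as [s3 [u3 [p3 [Hs3 [Hsol3 Hz3]]]]].
{ intros u p Hsol; rewrite Hchange; destruct (Hstar u p Hsol).
  eapply Rlt_le_trans; [|apply Rmax_r]; lra. }
{ intros u p Hsol; rewrite Hchange; destruct (HbigS u p Hsol).
  apply Rmax_lub_lt; lra. }
rewrite Hchange in Hz1, Hz2, Hz3; apply Ropp_eq_0_compat in Hz2; rewrite Ropp_involutive in Hz2.
destruct (Hsep s1 u1 p1 (-1) ltac:(lra) Hsol1 ltac:(lra) Hz1) as [HF1 HP1].
destruct (Hsep s2 u2 p2 (-1) ltac:(lra) Hsol2 ltac:(lra) Hz2) as [HF2 HP2].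
destruct (Hsep s3 u3 p3 1 ltac:(lra) Hsol3 ltac:(lra) Hz3) as [HF3 HP3].
assert (Hnstar : forall s u p, sol (Hcl K) mu s u p -> F u p = 0 -> s <> ss).
{ intros s u p Hsol HF E; rewrite E in Hsol; destruct (Hstar u p Hsol); lra. }
pose proof (Hnstar s1 u1 p1 Hsol1 HF1) as N1.
pose proof (Hnstar s2 u2 p2 Hsol2 HF2) as N2.
assert (N0 : s1 <> 0).
{ intro E; rewrite E in Hsol1; destruct (Hzero u1 p1 Hsol1); lra. }
exists u1, u2, u3.
split; [apply (Hpos s1 u1 p1); [lra|exact Hsol1|exact HF1]|].
split; [apply (Hpos s2 u2 p2); [lra|exact Hsol2|exact HF2]|].
split; [apply (Hpos s3 u3 p3); [lra|exact Hsol3|exact HF3]|].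
split; [apply (sol_differ _ _ _ _ _ _ _ _ Hsol1 Hsol2); left; lra|].
split; [apply (sol_differ _ _ _ _ _ _ _ _ Hsol1 Hsol3); left; lra|].
(* [s2] and [s3] might coincide, as an initial value problem may have several solutions; [Phi],
   above [r] for one and below [r] for the other, still separates them. *)
apply (sol_differ _ _ _ _ _ _ _ _ Hsol2 Hsol3); right.
apply NNPP; intro Hn; apply not_or_and in Hn; destruct Hn as [Hn1 Hn2].
apply NNPP in Hn1; apply NNPP in Hn2.
unfold Phi in HP2, HP3; rewrite Hn1, Hn2 in HP2; lra.
Qed.

End Main.

Theorem theorem1p1 (L alpha beta gamma delta : R) (a b g k : R -> R)
  (HL : 0 < L)
  (Hal : 0 <= alpha) (Hbe : 0 <= beta) (Hga : 0 <= gamma) (Hde : 0 <= delta)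
  (Hpar : gamma * beta + alpha * gamma + alpha * delta > 0)
  (Ha_cont : cont_on (in0L L) a) (Hb_cont : cont_on (in0L L) b)
  (Ha_nn : forall x, in0L L x -> 0 <= a x)
  (Hb_nn : forall x, in0L L x -> 0 <= b x)
  (Hab : exists tau sigma, 0 < tau /\ tau < sigma /\ sigma < L /\
     (forall x, (0 < x < tau \/ sigma < x < L) -> 0 < a x) /\
     (forall x, tau <= x <= sigma -> a x = 0) /\
     (forall x, tau < x < sigma -> 0 < b x) /\
     (forall x, (0 <= x <= tau \/ sigma <= x <= L) -> b x = 0))
  (Hg_cont : cont_on (fun s => 0 <= s) g) (Hk_cont : cont_on (fun s => 0 <= s) k)
  (Hg_nn : forall s, 0 <= s -> 0 <= g s) (Hk_nn : forall s, 0 <= s -> 0 <= k s)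
  (Hg0 : g 0 = 0) (Hk0 : k 0 = 0)
  (Hg_pos : forall s, 0 < s -> 0 < g s) (Hk_pos : forall s, 0 < s -> 0 < k s)
  (* limsup_{s->0+} g(s)/s = 0 *)
  (Hg_zero : forall eps, 0 < eps -> exists del, 0 < del /\
       forall s, 0 < s < del -> g s / s < eps)
  (* liminf_{s->+oo} g(s)/s = +oo *)
  (Hg_inf : forall M, exists R0, forall s, R0 < s -> M < g s / s)
  (* limsup_{s->0+} k(s)/s < +oo *)
  (Hk_zero : exists C del, 0 < del /\ forall s, 0 < s < del -> k s / s <= C) :
  exists mu_star, 0 < mu_star /\
    forall mu, mu_star < mu ->
      exists u1 u2 u3 : R -> R,
        is_positive_solution L alpha beta gamma delta mu a b g k u1 /\
        is_positive_solution L alpha beta gamma delta mu a b g k u2 /\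
        is_positive_solution L alpha beta gamma delta mu a b g k u3 /\
        differ_on L u1 u2 /\ differ_on L u1 u3 /\ differ_on L u2 u3.
Proof.
destruct Hab as [tau [sigma [Htau [Hts [HsL [Ha_pos [Ha_0 [Hb_pos Hb_0]]]]]]]].
apply (three_positive_solutions L alpha beta gamma delta a b g k HL Hal Hbe Hga Hde Hpar
  Ha_cont Hb_cont Ha_nn Hb_nn tau sigma); assumption.
Qed.
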